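(* Let $\Omega$ be a bounded simply connected domain in $\mathbb{R}^2$. Let $\widetilde S\subset\Omega$ be a square such that $\partial\widetilde S\cap\partial\Omega\ne\emptyset$. Let $B\in\Omega\setminus\widetilde S^{\mathrm{cl}}$. Then there exists a square $Q\subset\Omega\setminus\widetilde S^{\mathrm{cl}}$ satisfying the following conditions: (i) $Q^{\mathrm{cl}}\cap\widetilde S^{\mathrm{cl}}\cap\Omega\ne\emptyset$; (ii) either $B\in Q^{\mathrm{cl}}$, or $\widetilde S$ and $B$ lie in different connected components of $\Omega\setminus Q^{\mathrm{cl}}$.
   Context: A domain is an open connected set. ''Square'' means an open square in $\mathbb{R}^2$ whose sides are parallel to the coordinate axes. $E^{\mathrm{cl}}$ denotes the closure of $E$. *)

(* Defs.v *)
From mathcomp Require Import all_boot all_order all_algebra.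
From mathcomp Require Import all_classical all_reals all_analysis.
Set Implicit Arguments.
Unset Strict Implicit.
Unset Printing Implicit Defensive.
Import Order.TTheory GRing.Theory Num.Theory.
Import numFieldNormedType.Exports.
Local Open Scope classical_set_scope.
Local Open Scope ring_scope.

Definition boundary {T : topologicalType} (E : set T) : set T :=
  closure E `\` interior E.

Definition domain {T : topologicalType} (E : set T) : Prop :=
  open E /\ connected E.

(* Paths and homotopies are total functions, constrained only on the unit
   interval and the unit square. *)
Definition path_connected (R : realType) {T : topologicalType} (E : set T) :
    Prop :=
  forall x y, E x -> E y ->
  exists g : R -> T,
    [/\ {within `[0, 1], continuous g}, g @` `[0, 1] `<=` E, g 0 = x & g 1 = y].

Definition loop_in (R : realType) {T : topologicalType} (E : set T)
    (g : R -> T) : Prop :=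
  [/\ {within `[0, 1], continuous g}, g @` `[0, 1] `<=` E & g 0 = g 1].

(* The homotopy [H (t, s)] has path parameter [t] and time [s], and keeps the
   base point [g 0] fixed. *)
Definition null_homotopic_in (R : realType) {T : topologicalType} (E : set T)
    (g : R -> T) : Prop :=
  exists H : R * R -> T,
    [/\ {within `[0, 1] `*` `[0, 1], continuous H},
        H @` (`[0, 1] `*` `[0, 1]) `<=` E,
        forall t : R, 0 <= t <= 1 -> H (t, 0) = g t,
        forall t : R, 0 <= t <= 1 -> H (t, 1) = g 0
      & forall s : R, 0 <= s <= 1 -> H (0, s) = g 0 /\ H (1, s) = g 0].

Definition simply_connected (R : realType) {T : topologicalType} (E : set T) :
    Prop :=
  path_connected R E /\
  forall g : R -> T, loop_in E g -> null_homotopic_in E g.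

Definition is_square (R : realType) (Q : set (R * R)) : Prop :=
  exists a b l : R, 0 < l /\ Q = `]a, a + l[ `*` `]b, b + l[.

Definition is_component {T : topologicalType} (E C : set T) : Prop :=
  (connected_component E @` E) C.

(* Main.v *)
Require Import Defs.
From mathcomp Require Import all_boot all_order all_algebra.
From mathcomp Require Import all_classical all_reals all_analysis.
From mathcomp Require Import ring lra zify.
Import Order.TTheory GRing.Theory Num.Theory.
Import numFieldNormedType.Exports.
Set Implicit Arguments.
Unset Strict Implicit.
Unset Printing Implicit Defensive.
Local Open Scope classical_set_scope.
Local Open Scope ring_scope.

                                                                           
                                                                            
                                                                              
                                                                                
                                                                             
                                                                               
                                                               

                                                                                 
                                                                               
                                                                                 
                                                                             
                                                                            
                                                                               
                                                                          
                                                                               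
                              

(** Axis-parallel squares are the balls of the sup norm, so write the given square as the ball of
    centre [c] and radius [h], and let [q t] be its boundary point in direction [t]. For [q t] in
    [Omega], slide a centre [z] along the ray from [c] through [q t] until its distance to the
    complement of [Omega] equals [rho - h], where [rho] is its distance to [c]. The ball of radius
    [rho - h] about [z] lies in [Omega], is disjoint from the closure of the given square, and its
    closure contains [q t]. These balls are the candidates for [Q]. Suppose that none works: then no
    closed candidate contains [B], and each is avoided by a connected subset of [Omega] containing
    both [c] and [B].

    Simple connectedness makes the angle around a point [w] outside [Omega] a single-valued function
    on [Omega] ([closed_chain_ang], [angle_function]). Hence the total turning around [w] from [c]
    to [B] is a number attached to [w] alone, and [angle_fun_diff] says how it varies when [w] moves
    inside a convex set avoided by a connected set joining [c] to [B]. Transport it from the point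
    where the candidate touches the complement to the centre [z], then correct it by the angle at
    [B] from [c] to [z] and by the direction [t]. The result, [sweep], is locally constant over all
    candidates ([sweep_locally_constant]), hence constant while [q t] runs over an open arc of the
    boundary of the square contained in [Omega] ([sweep_const]).

    Since [Omega] is connected, some point [v] outside the closed square is visible from [c] inside
    [Omega] and is joined to [B] outside the closed square ([access]). Take the maximal arc around
    the direction of [v]; its ends [q ta] and [q tb] lie outside [Omega] because the square touches
    the boundary. Near each end, [sweep] equals the same expression with the end itself as the
    outside point ([sweep_end]). Comparing the two ends along the segment from [c] to [v] and then
    outside the square, everything cancels except angle sums of the triangles with vertices [c], [v]
    and [q ta] or [q tb]. These triangles lie on opposite sides of the ray to [v], so the sums
    differ by a full turn ([triangle_right], [triangle_left]), contradicting constancy; this is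
    [separation_absurd].

    Instead of paths, most arguments use [connected_locally_constant]: a locally constant function
    on a connected set is constant. *)

Lemma connected_locally_constant (T : topologicalType) (X : Type) (A : set T)
    (f : T -> X) : connected A ->
  (forall x, A x -> \forall y \near x, A y -> f y = f x) ->
  forall x y, A x -> A y -> f x = f y.
Proof.
move=> cA lf x y Ax Ay.
suff AE : A `&` [set z | f z = f x] = A.
  by have [_ ->] : (A `&` [set z | f z = f x]) y by rewrite AE.
apply: cA.
- by exists x.
- exists (interior [set z | A z -> f z = f x]); first exact: open_interior.
  apply/seteqP; split => z /= [Az fz]; split => //.
    rewrite /interior/=; move: (lf _ Az); apply: filterS => w fw Aw.
    by rewrite fw.
  exact: (interior_subset fz Az).
- exists (~` interior [set z | A z -> f z <> f x]).
    by apply: open_closedC; exact: open_interior.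
  apply/seteqP; split => z /= [Az fz]; split => //.
    by move=> /interior_subset /(_ Az).
  apply: contrapT => fzx; apply: fz; rewrite /interior/=.
  by move: (lf _ Az); apply: filterS => w fw Aw; rewrite fw.
Qed.

                        

(** * Signed angles between plane vectors and their additivity *)

Section Angles.
Variable R : realType.
Implicit Types (p q x y w : R * R) (s t a b : R).

Definition congr2pi a b := exists k : int, a = b + pi *+ 2 *~ k.

Lemma congr2pi_refl a : congr2pi a a.
Proof. by exists 0; rewrite mulr0z addr0. Qed.

Lemma congr2pi_sym a b : congr2pi a b -> congr2pi b a.
Proof. by case=> k ->; exists (- k); rewrite mulrNz addrK. Qed.

Lemma congr2piD a b a' b' :
  congr2pi a a' -> congr2pi b b' -> congr2pi (a + b) (a' + b').
Proof. by move=> [k ->] [l ->]; exists (k + l); rewrite mulrzDr; ring. Qed.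

Lemma congr2piN a a' : congr2pi a a' -> congr2pi (- a) (- a').
Proof. by move=> [k ->]; exists (- k); rewrite mulrNz; ring. Qed.

Lemma congr2piB a b a' b' :
  congr2pi a a' -> congr2pi b b' -> congr2pi (a - b) (a' - b').
Proof. by move=> h /congr2piN; exact: congr2piD. Qed.

Lemma congr2pi_trans a b c : congr2pi a b -> congr2pi b c -> congr2pi a c.
Proof. by move=> [k ->] [l ->]; exists (k + l); rewrite mulrzDr; ring. Qed.

Lemma congr2pi0_eq a b : congr2pi a b -> `|a - b| < pi *+ 2 -> a = b.
Proof.
move=> [k ->]; rewrite addrAC subrr add0r.
have pi0 := @pi_gt0 R.
rewrite -mulrzl normrM (@ger0_norm _ (pi *+ 2)); last by lra.
rewrite -intr_norm -[X in _ < X]mul1r ltr_pM2r; last by lra.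
rewrite -[X in _ < X]/(1%:~R) ltr_int => k1.
by have -> : k = 0; [lia|rewrite mul0r addr0].
Qed.

Lemma congr2pi_near0 a b : congr2pi a b -> `|a - b| < pi -> a = b.
Proof.
move=> h ab; apply: (congr2pi0_eq h); apply: lt_le_trans ab _.
have := @pi_gt0 R; lra.
Qed.

Lemma congr2pi_norm a : exists2 d, congr2pi a d & - pi <= d < pi.
Proof.
have pi0 := @pi_gt0 R.
pose k := Num.floor ((a + pi) / (pi *+ 2)).
exists (a - pi *+ 2 *~ k); first by exists k; rewrite subrK.
have := floor_itv ((a + pi) / (pi *+ 2)); rewrite -/k => /andP[].
rewrite ler_pdivlMr ?ltr_pdivrMr; [|lra|lra].
rewrite intrD -[pi *+ 2 *~ k]mulrzl /= => h1 h2.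
by apply/andP; split; nra.
Qed.

Lemma cos_congr2pi a b : congr2pi a b -> cos a = cos b.
Proof.
have P k c : cos (c + pi *+ 2 *+ k) = cos c :> R.
  by apply: periodicn; exact: cosD2pi.
move=> [[k|k] ->]; first exact: P.
rewrite NegzE mulrNz -[LHS](P k.+1) -pmulrn subrK //.
Qed.

Lemma sin_congr2pi a b : congr2pi a b -> sin a = sin b.
Proof.
have P k c : sin (c + pi *+ 2 *+ k) = sin c :> R.
  by apply: periodicn; exact: sinD2pi.
move=> [[k|k] ->]; first exact: P.
rewrite NegzE mulrNz -[LHS](P k.+1) -pmulrn subrK //.
Qed.

Definition dot p q := p.1 * q.1 + p.2 * q.2.
Definition cross p q := p.1 * q.2 - p.2 * q.1.
Definition enorm p := Num.sqrt (dot p p).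

                                                                          
(** By Cauchy-Schwarz the quantity is never negative; it vanishes exactly when one vector is zero or
    the two point in opposite directions. It is also the denominator in [ang]. *)
Definition nonopp p q := 0 < enorm p * enorm q + dot p q.

                                                                                
                                                   
(** The half-angle formula tan(d/2) = sin d / (1 + cos d) gives the signed Euclidean angle in the
    open interval from -pi to pi without a choice of branch. On opposite vectors the division by
    zero gives the junk value 0, whence the side conditions [nonopp]. *)
Definition ang p q :=
  atan (cross p q / (enorm p * enorm q + dot p q)) *+ 2.

Definition polar p t := exists2 r, 0 < r & p = (r * cos t, r * sin t).

Lemma polar_enorm t a : 0 < a -> enorm (a * cos t, a * sin t) = a.
Proof.
move=> a0; rewrite /enorm /dot /=.
have -> : a * cos t * (a * cos t) + a * sin t * (a * sin t) = a ^+ 2.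
  by transitivity (a ^+ 2 * (cos t ^+ 2 + sin t ^+ 2)); [ring|
    rewrite cos2Dsin2 mulr1].
by rewrite sqrtr_sqr gtr0_norm.
Qed.

Lemma polar_ex p : p != 0 -> exists t, polar p t.
Proof.
case: p => p1 p2 p0; pose n := p1 ^+ 2 + p2 ^+ 2.
have n0 : 0 < n.
  rewrite lt_neqAle addr_ge0 ?sqr_ge0 // andbT eq_sym.
  apply: contraNneq p0 => /eqP; rewrite paddr_eq0 ?sqr_ge0 //.
  by rewrite !sqrf_eq0 => /andP[/eqP -> /eqP ->].
pose r := Num.sqrt n.
have r0 : 0 < r by rewrite sqrtr_gt0.
have r2 : r ^+ 2 = n by rewrite sqr_sqrtr // ltW.
pose c := p1 / r; pose s := p2 / r.
have cs : c ^+ 2 + s ^+ 2 = 1.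
  by rewrite /c /s !expr_div_n r2 -mulrDl divff // gt_eqF.
have c1 : -1 <= c <= 1.
  rewrite -ler_norml -(@ler_pXn2r _ 2) ?nnegrE // expr1n.
  by rewrite real_normK ?num_real // -cs lerDl sqr_ge0.
have sE : `|s| = sin (acos c).
  by rewrite sin_acos // -cs addrAC subrr add0r sqrtr_sqr.
have p1E : p1 = r * c by rewrite /c mulrC divfK // gt_eqF.
have p2E : p2 = r * s by rewrite /s mulrC divfK // gt_eqF.
have [s0|s0] := leP 0 s.
  exists (acos c), r => //.
  by rewrite acosK ?in_itv //= -sE ger0_norm // -p1E -p2E.
exists (- acos c), r => //.
by rewrite cosN sinN acosK ?in_itv //= -sE ltr0_norm // opprK -p1E -p2E.
Qed.

Lemma polar_congr p s t : polar p s -> congr2pi s t -> polar p t.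
Proof.
move=> [r r0 ->] st; exists r => //.
by rewrite (cos_congr2pi st) (sin_congr2pi st).
Qed.

Lemma polar_neq0 p t : polar p t -> p != 0.
Proof.
move=> [r r0 ->]; apply/eqP => -[/eqP c /eqP s]; move: c s.
rewrite !mulf_eq0 gt_eqF //= => /eqP c /eqP s.
by have := cos2Dsin2 t; rewrite c s expr0n /= addr0 => /esym/eqP; rewrite oner_eq0.
Qed.

Lemma polarN p t : polar p t -> polar (- p) (t + pi).
Proof.
by move=> [r r0 ->]; exists r => //; rewrite cosDpi sinDpi !mulrN.
Qed.

Lemma ang_polar_eq p q s t : polar p s -> polar q t -> `|t - s| < pi ->
  ang p q = t - s.
Proof.
move=> [a a0 ->] [b b0 ->]; rewrite ltr_norml => /andP[ts1 ts2].
rewrite /ang !polar_enorm // /cross /dot /=.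
pose d := (t - s) / 2.
have dE : t - s = d *+ 2 by rewrite /d -mulr_natr divfK.
have cd : 0 < cos d by apply: cos_gt0_pihalf; rewrite /d; apply/andP; split; lra.
have -> : a * b + (a * cos s * (b * cos t) + a * sin s * (b * sin t)) =
  a * b * (1 + cos (t - s)) by rewrite cosB; ring.
have -> : a * cos s * (b * sin t) - a * sin s * (b * cos t) =
  a * b * sin (t - s) by rewrite sinB; ring.
rewrite -mulf_div divff ?mul1r; last by rewrite mulf_neq0 // gt_eqF.
rewrite dE sin_mulr2n cos_mulr2n addrC subrK.
have -> : (cos d * sin d) *+ 2 / (cos d ^+ 2 *+ 2) = tan d.
  by rewrite /tan; field; rewrite gt_eqF.
by rewrite tanK // in_itv /=; rewrite /d; apply/andP; split; lra.
Qed.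

Lemma nonopp_neq0 p q : nonopp p q -> (p != 0) && (q != 0).
Proof.
rewrite /nonopp /enorm /dot => h; apply/andP; split; apply: contraTneq h => ->;
  by rewrite /= !(mul0r,mulr0) !addr0 sqrtr0 !(mul0r,mulr0) ltxx.
Qed.

Lemma ang_congr p q s t : nonopp p q -> polar p s -> polar q t ->
  congr2pi (ang p q) (t - s).
Proof.
move=> pq ps qt; have [d td /andP[d1 d2]] := congr2pi_norm (t - s).
have qd : polar q (s + d).
  apply: polar_congr qt _; have := congr2piD (congr2pi_refl s) td.
  by rewrite addrC subrK.
apply: congr2pi_trans (congr2pi_sym td).
rewrite (ang_polar_eq ps qd); first by rewrite addrAC subrr add0r; exact: congr2pi_refl.
rewrite addrAC subrr add0r ltr_norml d2 andbT lt_neqAle d1 andbT.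
apply: contraTneq pq => dE; rewrite /nonopp.
case: ps qd => a a0 -> [b b0 ->]; rewrite !polar_enorm //.
rewrite -dE cosB sinB cospi sinpi /dot /= -leNgt.
rewrite [X in X <= 0](_ : _ = a * b * (1 - (cos s ^+ 2 + sin s ^+ 2))); last by ring.
by rewrite cos2Dsin2 subrr mulr0.
Qed.

Lemma ang_pp p : ang p p = 0.
Proof. by rewrite /ang /cross (mulrC p.1) subrr mul0r atan0 mul0rn. Qed.

Lemma angC p q : ang q p = - ang p q.
Proof.
rewrite /ang -mulNrn -atanN -mulNr; congr (atan (_ / _) *+ 2).
- by rewrite /cross; ring.
- by rewrite /dot; ring.
Qed.

Lemma nonoppC p q : nonopp p q -> nonopp q p.
Proof. by rewrite /nonopp /dot mulrC (mulrC p.1) (mulrC p.2). Qed.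

Lemma nonopp_pp p : p != 0 -> nonopp p p.
Proof.
move=> /polar_ex[t [r r0 ->]]; rewrite /nonopp polar_enorm // /dot /=.
have := cos2Dsin2 t; nra.
Qed.

Definition lin s p q : R * R :=
  (p.1 + s * (q.1 - p.1), p.2 + s * (q.2 - p.2)).

Lemma lin0 p q : lin 0 p q = p.
Proof. by case: p => p1 p2; rewrite /lin /= !mul0r !addr0. Qed.

Lemma lin1 p q : lin 1 p q = q.
Proof. by case: q => q1 q2; rewrite /lin /=; congr pair; ring. Qed.

Lemma linB s p q w : lin s p q - w = lin s (p - w) (q - w).
Proof. by congr pair => /=; ring. Qed.

Lemma lin_lin s t u p q : lin u (lin s p q) (lin t p q) = lin (s + u * (t - s)) p q.
Proof. by congr pair => /=; ring. Qed.

Lemma lin_rev s p q : lin s q p = lin (1 - s) p q.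
Proof. by congr pair => /=; ring. Qed.

Lemma lin_cone s u p q r : lin u (lin s p q) (lin s p r) = lin s p (lin u q r).
Proof. by congr pair => /=; ring. Qed.

Lemma nonopp_lin p q : (forall s, 0 <= s <= 1 -> lin s p q <> 0) -> nonopp p q.
Proof.
move=> H; rewrite /nonopp ltNge; apply/negP => pq.
have p0 : p != 0.
  apply/eqP => p0; apply: (H 0); rewrite ?lexx ?ler01 // p0 /lin /=.
  by rewrite !mul0r !addr0.
have q0 : q != 0.
  apply/eqP => q0; apply: (H 1); rewrite ?lexx ?ler01 // q0 /lin /=.
  by rewrite !mul1r !sub0r !subrr.
have [[s [a a0 pE]] [t [b b0 qE]]] := (polar_ex p0, polar_ex q0).
move: pq; rewrite pE qE !polar_enorm // /dot /= => pq.
have ab : 0 < a + b by lra.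
have st : cos (s - t) = -1.
  apply/eqP; rewrite eq_le cos_geN1 andbT.
  have {}pq : (a * b) * (1 + cos (s - t)) <= 0 by rewrite cosB; nra.
  have {}pq : 1 + cos (s - t) <= 0 by rewrite -(pmulr_rle0 _ (mulr_gt0 a0 b0)).
  by lra.
have sst : sin (s - t) = 0 by apply: cos1sin0; rewrite st normrN1.
have cE : cos s = - cos t.
  by rewrite -(subrK t s) cosD st sst; ring.
have sE : sin s = - sin t.
  by rewrite -(subrK t s) sinD st sst; ring.
(* Opposite vectors of lengths [a] and [b]: the segment between them meets the origin at this
   ratio. *)
apply: (H (a / (a + b))).
  by rewrite divr_ge0 ?(ltW a0) ?(ltW ab) //= ler_pdivrMr // mul1r; lra.
rewrite pE qE /lin /= cE sE.
by congr pair; field; rewrite gt_eqF.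
Qed.

Section Cvg.
Context {T : Type} (F : set_system T) {FF : Filter F}.

Lemma cvg_fst1 (f : T -> R * R) p : f @ F --> p -> (f x).1 @[x --> F] --> p.1.
Proof. by move=> fp; apply: cvg_comp fp _; exact: cvg_fst. Qed.

Lemma cvg_snd1 (f : T -> R * R) p : f @ F --> p -> (f x).2 @[x --> F] --> p.2.
Proof. by move=> fp; apply: cvg_comp fp _; exact: cvg_snd. Qed.

Lemma cvg_dot (f g : T -> R * R) p q : f @ F --> p -> g @ F --> q ->
  dot (f x) (g x) @[x --> F] --> dot p q.
Proof.
move=> fp gq.
by apply: cvgD; apply: cvgM; first [exact: cvg_fst1|exact: cvg_snd1].
Qed.

Lemma cvg_cross (f g : T -> R * R) p q : f @ F --> p -> g @ F --> q ->
  cross (f x) (g x) @[x --> F] --> cross p q.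
Proof.
move=> fp gq.
by apply: cvgB; apply: cvgM; first [exact: cvg_fst1|exact: cvg_snd1].
Qed.

Lemma cvg_enorm (f : T -> R * R) p : f @ F --> p ->
  enorm (f x) @[x --> F] --> enorm p.
Proof.
move=> fp; apply: (@cvg_comp _ _ _ _ (@Num.sqrt R)); first exact: (cvg_dot fp fp).
exact: sqrt_continuous.
Qed.

Lemma cvg_enorm_dot (f g : T -> R * R) p q : f @ F --> p -> g @ F --> q ->
  enorm (f x) * enorm (g x) + dot (f x) (g x) @[x --> F] -->
  enorm p * enorm q + dot p q.
Proof.
move=> fp gq; apply: cvgD; last exact: cvg_dot.
by apply: cvgM; exact: cvg_enorm.
Qed.

Lemma cvg_ang (f g : T -> R * R) p q : f @ F --> p -> g @ F --> q ->
  nonopp p q -> ang (f x) (g x) @[x --> F] --> ang p q.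
Proof.
move=> fp gq pq; apply: cvgMn.
apply: (@cvg_comp _ _ _ _ (@atan R)); last exact: continuous_atan.
apply: cvgM; first exact: cvg_cross.
apply: cvgV; first by rewrite gt_eqF.
exact: cvg_enorm_dot.
Qed.

Lemma near_nonopp (f g : T -> R * R) p q : f @ F --> p -> g @ F --> q ->
  nonopp p q -> \forall x \near F, nonopp (f x) (g x).
Proof.
by move=> fp gq pq; apply: (cvgr_gt _ (cvg_enorm_dot fp gq)).
Qed.

Lemma cvg_mkpair (f g : T -> R) a b : f @ F --> a -> g @ F --> b ->
  (f x, g x) @[x --> F] --> (a, b).
Proof. by move=> fa gb; exact: (@cvg_pair _ _ _ F (nbhs a) (nbhs b)). Qed.

Lemma cvg_lin (r : T -> R) (f g : T -> R * R) p q s : r @ F --> s ->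
  f @ F --> p -> g @ F --> q ->
  lin (r t) (f t) (g t) @[t --> F] --> lin s p q.
Proof.
move=> rs fp gq; apply: cvg_mkpair; apply: cvgD; do ?[exact: cvg_fst1|exact: cvg_snd1];
  by apply: cvgM => //; apply: cvgB; do ?[exact: cvg_fst1|exact: cvg_snd1].
Qed.

End Cvg.

Definition convex_pl (K : set (R * R)) :=
  forall p q s, K p -> K q -> 0 <= s <= 1 -> K (lin s p q).

Lemma ang_cocycle_congr p q r : nonopp p q -> nonopp q r -> nonopp r p ->
  congr2pi (ang p q + ang q r + ang r p) 0.
Proof.
move=> pq qr rp; have /andP[p0 q0] := nonopp_neq0 pq.
have /andP[r0 _] := nonopp_neq0 rp.
have [[s ps] [[t qt] [u ru]]] :=
  (polar_ex p0, (polar_ex q0, polar_ex r0)).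
have -> : 0 = (t - s) + (u - t) + (s - u) by ring.
by apply: congr2piD; [apply: congr2piD|]; exact: ang_congr.
Qed.

(** Values in a single class modulo 2 pi are discrete, so continuity forbids any jump. This turns
    congruences between angles into equalities. *)
Lemma continuous_congr_const (I : set R) (f : R -> R) (c : R) :
  is_interval I ->
  (forall s, I s -> f @ s --> f s) ->
  (forall s, I s -> congr2pi (f s) c) ->
  forall s t, I s -> I t -> f s = f t.
Proof.
move=> /connected_intervalP cI fc fI; apply: connected_locally_constant => // x Ix.
have /cvgr_distC_lt /(_ pi (@pi_gt0 R)) := fc _ Ix.
apply: filterS => y fxy Iy.
apply: congr2pi_near0 => //.
exact: congr2pi_trans (fI _ Iy) (congr2pi_sym (fI _ Ix)).
Qed.

                                                                        
                                                                       
(** Shrink the triangle to its vertex [p]. Because the filled triangle misses the origin, the sum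
    stays continuous and a multiple of 2 pi throughout, and it is 0 for the degenerate triangle. *)
Lemma ang_cocycle_triangle p q r :
  (forall s u, 0 <= s <= 1 -> 0 <= u <= 1 -> lin s p (lin u q r) <> 0) ->
  ang p q + ang q r + ang r p = 0.
Proof.
move=> H0.
pose f s := ang p (lin s p q) + ang (lin s p q) (lin s p r) + ang (lin s p r) p.
transitivity (f 1); first by rewrite /f !lin1.
transitivity (f 0); last by rewrite /f !lin0 ang_pp !addr0.
pose I := [set` `[0 : R, 1]].
have II : is_interval I by exact: interval_is_interval.
have i0 : 0 <= (0 : R) <= 1 by rewrite lexx ler01.
have i1 : 0 <= (1 : R) <= 1 by rewrite lexx ler01.
have no s : I s -> nonopp (lin s p q) (lin s p r).
  rewrite /I /= in_itv /= => s01.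
  by apply: nonopp_lin => u u01; rewrite lin_cone; exact: H0.
have no1 s v : 0 <= v <= 1 -> I s -> nonopp p (lin s p (lin v q r)).
  rewrite /I /= in_itv /= => v01 /andP[s0 s1].
  apply: nonopp_lin => u /andP[u0 u1].
  rewrite -{1}(lin0 p (lin v q r)) lin_lin; apply: H0 => //.
  by apply/andP; split; nra.
have noq s : I s -> nonopp p (lin s p q) by move=> /(no1 _ _ i0); rewrite lin0.
have nor s : I s -> nonopp p (lin s p r) by move=> /(no1 _ _ i1); rewrite lin1.
have cl (x : R * R) s : lin t p x @[t --> s] --> lin s p x.
  by apply: cvg_lin; [exact: cvg_id|exact: cvg_cst|exact: cvg_cst].
apply: (@continuous_congr_const I f 0 II) => [s Is|s Is| |].
- apply: cvgD; first apply: cvgD; apply: cvg_ang => //;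
    first [exact: cvg_cst|exact: cl|exact: noq|exact: no|by apply: nonoppC; exact: nor].
- by apply: ang_cocycle_congr; [exact: noq|exact: no|apply: nonoppC; exact: nor].
- by rewrite /I /= in_itv /= lexx ler01.
- by rewrite /I /= in_itv /= lexx ler01.
Qed.

Lemma ang_cocycle (K : set (R * R)) p q r : convex_pl K -> ~ K 0 ->
  K p -> K q -> K r -> ang p q + ang q r + ang r p = 0.
Proof.
move=> cK K0 Kp Kq Kr; apply: ang_cocycle_triangle => s u s01 u01 e.
by apply: K0; rewrite -e; apply: (cK) => //; exact: cK.
Qed.

Lemma ang_add (K : set (R * R)) p q r : convex_pl K -> ~ K 0 ->
  K p -> K q -> K r -> ang p q + ang q r = ang p r.
Proof.
move=> cK K0 Kp Kq Kr; have := ang_cocycle cK K0 Kp Kq Kr.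
by rewrite (angC p r) => /eqP; rewrite subr_eq0 => /eqP.
Qed.

End Angles.

                                                           

(** * Winding of closed polygons and the angle function of a simply connected domain *)

Section Winding.
Variable R : realType.
Implicit Types (p q w : R * R) (s t : R).

Lemma pair_norm_lt (x : R * R) (a : R) : (`|x| < a) = (`|x.1| < a) && (`|x.2| < a).
Proof. by rewrite prod_normE gt_max. Qed.

Lemma pair_norm_le (x : R * R) (a : R) : (`|x| <= a) = (`|x.1| <= a) && (`|x.2| <= a).
Proof. by rewrite prod_normE ge_max. Qed.

Lemma norm_lin_le s p q (a b : R) : 0 <= s <= 1 -> `|p| <= a -> `|q| <= b ->
  `|lin s p q| <= (1 - s) * a + s * b.
Proof.
move=> /andP[s0 s1]; rewrite !pair_norm_le => /andP[p1 p2] /andP[q1 q2].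
move: p1 p2 q1 q2; rewrite !ler_norml => /andP[? ?] /andP[? ?] /andP[? ?] /andP[? ?].
by apply/andP; split; apply/andP; split; rewrite /lin /=; nra.
Qed.

Lemma convex_ball (y : R * R) (a : R) : convex_pl [set x | `|x - y| < a].
Proof.
move=> p q s /= pa qa s01; rewrite linB.
apply: le_lt_trans (norm_lin_le s01 (lexx _) (lexx _)) _.
move: s01 => /andP[]; rewrite le_eqVlt => /orP[/eqP <- _|s0 s1]; first by lra.
by nra.
Qed.

Lemma convex_closed_ball (y : R * R) (a : R) : convex_pl [set x | `|x - y| <= a].
Proof.
move=> p q s /= pa qa s01; rewrite linB.
by apply: le_trans (norm_lin_le s01 pa qa) _; lra.
Qed.

Lemma convex_shift (K : set (R * R)) w : convex_pl K ->
  convex_pl [set x | K (x + w)].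
Proof.
move=> cK p q s Kp Kq s01 /=.
have -> : lin s p q + w = lin s (p + w) (q + w) by congr pair => /=; ring.
exact: cK.
Qed.

Definition segment_in (E : set (R * R)) p q := forall s, 0 <= s <= 1 -> E (lin s p q).

Lemma convex_segment p q : convex_pl [set x | exists2 s, 0 <= s <= 1 & x = lin s p q].
Proof.
move=> x y u [s /andP[s0 s1] ->] [t /andP[t0 t1] ->] /andP[u0 u1].
by exists (s + u * (t - s)); [apply/andP; split; nra|rewrite lin_lin].
Qed.

Lemma ang_subdivide p q m : (0 < m)%N -> (forall s, 0 <= s <= 1 -> lin s p q <> 0) ->
  \sum_(i < m) ang (lin (i%:R / m%:R) p q) (lin (i.+1%:R / m%:R) p q) = ang p q.
Proof.
move=> m0 pq0.
have mr : 0 < m%:R :> R by rewrite ltr0n.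
have frac k : (k <= m)%N -> 0 <= (k%:R / m%:R : R) <= 1.
  by move=> km; rewrite divr_ge0 //= ler_pdivrMr // mul1r ler_nat.
suff H k : (k <= m)%N ->
    \sum_(i < k) ang (lin (i%:R / m%:R) p q) (lin (i.+1%:R / m%:R) p q) =
    ang p (lin (k%:R / m%:R) p q).
  by rewrite H // divff ?gt_eqF // lin1.
elim: k => [_|k IH km]; first by rewrite big_ord0 mul0r lin0 ang_pp.
rewrite big_ord_recr /= IH ?(ltnW km) //.
apply: (ang_add (@convex_segment p q)).
- by move=> [s s01 /esym]; exact: pq0.
- by exists 0; rewrite ?lin0 // lexx ler01.
- by exists (k%:R / m%:R); rewrite ?frac // ltnW.
- by exists (k.+1%:R / m%:R); rewrite ?frac.
Qed.

                                                                            
                           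
(** A discrete homotopy invariance: in each cell both routes between opposite corners have the same
    angle, so passing from one row to the next changes the row sum by a telescoping sum of vertical
    edges, which cancels since the two sides agree. The last row is a single point and contributes
    0. *)
Lemma ang_grid_sum (N : nat) (h : nat -> nat -> R * R) :
  (forall i j, (i < N)%N -> (j < N)%N -> exists K : set (R * R), [/\ convex_pl K, ~ K 0,
    K (h i j) /\ K (h i.+1 j) & K (h i j.+1) /\ K (h i.+1 j.+1)]) ->
  (forall j, (j <= N)%N -> h 0%N j = h N j) ->
  (forall i, (i < N)%N -> h i N = h i.+1 N) ->
  \sum_(i < N) ang (h i 0%N) (h i.+1 0%N) = 0.
Proof.
move=> cell side top.
suff H j : (j <= N)%N -> \sum_(i < N) ang (h i 0%N) (h i.+1 0%N) =
    \sum_(i < N) ang (h i j) (h i.+1 j).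
  by rewrite (H N) // big1 // => i _; rewrite top // ang_pp.
elim: j => // j IH jN; rewrite IH ?(ltnW jN) //.
apply/eqP; rewrite -subr_eq0 -sumrB.
rewrite (eq_bigr (fun i : 'I_N => ang (h i j) (h i j.+1) - ang (h i.+1 j) (h i.+1 j.+1))).
  rewrite -(big_mkord xpredT (fun i => ang (h i j) (h i j.+1) - ang (h i.+1 j) (h i.+1 j.+1))).
  rewrite (@telescope_sumr_eq _ _ _ (fun i => - ang (h i j) (h i j.+1))) //.
    by rewrite side ?(ltnW jN) // side // subrr.
  by move=> k _; rewrite opprK addrC.
move=> i _; have [K [cK K0 [K1 K2] [K3 K4]]] := cell i j (ltn_ord i) jN.
have e1 := ang_add cK K0 K1 K2 K4.
have e2 := ang_add cK K0 K1 K3 K4.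
lra.
Qed.

Definition clamp01 s : R := Num.min 1 (Num.max 0 s).

Lemma clamp01_itv s : 0 <= clamp01 s <= 1.
Proof. by rewrite /clamp01 le_min ler01 le_max lexx /= ge_min lexx. Qed.

Lemma clamp01_id s : 0 <= s <= 1 -> clamp01 s = s.
Proof.
by move=> /andP[s0 s1]; rewrite /clamp01 (max_idPr s0) (min_idPr s1).
Qed.

Lemma clamp01_le0 s : s <= 0 -> clamp01 s = 0.
Proof. by move=> s0; rewrite /clamp01 (max_idPl s0) (min_idPr ler01). Qed.

Lemma clamp01_ge1 s : 1 <= s -> clamp01 s = 1.
Proof.
move=> s1; rewrite /clamp01 (max_idPr _) ?(min_idPl s1) //.
exact: le_trans ler01 s1.
Qed.

Lemma continuous_clamp01 : continuous clamp01.
Proof.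
rewrite -[clamp01]/((fun=> 1) \min ((fun=> 0) \max id)) => s.
apply: continuous_min; first exact: cvg_cst.
by apply: continuous_max; [exact: cvg_cst|exact: cvg_id].
Qed.

(** Writing the piecewise linear interpolation as a sum of clamped increments makes it continuous on
    the whole line with no gluing of pieces. *)
Fixpoint polyline (a : nat -> R) n s : R :=
  if n is k.+1 then polyline a k s + clamp01 (s - k%:R) * (a k.+1 - a k) else a 0%N.

Lemma continuous_polyline a n : continuous (polyline a n).
Proof.
elim: n => [|n IH] s /=; first exact: cvg_cst.
apply: cvgD; first exact: IH.
apply: cvgM; last exact: cvg_cst.
apply: (@cvg_comp _ _ _ _ clamp01); last exact: continuous_clamp01.
by apply: cvgB; [exact: cvg_id|exact: cvg_cst].
Qed.

Lemma polyline_ge (a : nat -> R) n s : n%:R <= s -> polyline a n s = a n.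
Proof.
elim: n => //= n IH ns.
have e : n.+1%:R = n%:R + 1 :> R by rewrite -natr1.
rewrite IH; last by lra.
by rewrite clamp01_ge1; [ring|lra].
Qed.

Lemma polylineE (a : nat -> R) n k s : (k < n)%N -> k%:R <= s <= k.+1%:R ->
  polyline a n s = a k + (s - k%:R) * (a k.+1 - a k).
Proof.
move=> + /andP[ks sk]; elim: n => // n IH.
have e : k.+1%:R = k%:R + 1 :> R by rewrite -natr1.
rewrite ltnS leq_eqVlt => /orP[/eqP <-|kn] /=.
  by rewrite polyline_ge // clamp01_id //; apply/andP; split; lra.
rewrite IH // clamp01_le0 ?mul0r ?addr0 //.
have : k.+1%:R <= n%:R :> R by rewrite ler_nat.
lra.
Qed.

Lemma unit_interval_index n s : (0 < n)%N -> 0 <= s <= n%:R ->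
  exists2 k, (k < n)%N & k%:R <= s <= k.+1%:R.
Proof.
elim: n => // n IH _ /andP[s0 sn].
have [ns|ns] := leP n%:R s; first by exists n; rewrite ?ns.
case: n => [|n] in IH sn ns *; first lra.
have [//| |k kn ks] := IH; first by rewrite s0 ltW.
by exists k => //; rewrite ltnS ltnW.
Qed.

Lemma within_continuous_comp (T U W : topologicalType) (A : set U) (f : T -> U) (g : U -> W) :
  continuous f -> (forall x, A (f x)) -> {within A, continuous g} -> continuous (g \o f).
Proof.
move=> cf fA /subspace_continuousP cg x.
apply: (@cvg_comp _ _ _ f g _ (within A (nbhs (f x)))); last exact: cg.
move=> P /= wP; have : nbhs x (f @^-1` [set y | A y -> P y]) by exact: cf.
by apply: filterS => y /(_ (fA y)).
Qed.

(** A Lebesgue number for the unit square. Near [a] the values of [G] lie in the ball about [G a]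
    whose radius is the distance to [w]; this ball is convex and misses [w]. Compactness makes the
    scale uniform. *)
Lemma uniform_cells (G : R * R -> R * R) w : continuous G -> (forall a, G a <> w) ->
  exists2 e, 0 < e & forall a, 0 <= a.1 <= 1 -> 0 <= a.2 <= 1 ->
    exists K : set (R * R), [/\ convex_pl K, ~ K 0 & forall b, `|b - a| < e -> K (G b - w)].
Proof.
move=> cG Gw.
have cpt : compact (`[0 : R, 1]%classic `*` `[0 : R, 1]%classic).
  by apply: compact_setX; exact: segment_compact.
move/compact_near_coveringP : cpt => /(_ R (0^'+)
  (fun e a => exists K : set (R * R),
     [/\ convex_pl K, ~ K 0 & forall b, `|b - a| < e -> K (G b - w)]) _).
case.
  move=> a _.
  pose r := `|G a - w|.
  have r0 : 0 < r by rewrite normr_gt0 subr_eq0; apply/eqP; exact: Gw.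
  have /cvgr_dist_lt /(_ _ r0) := cG a.
  move=> /nbhs_ballP[d /= d0 ad].
  exists (ball a (d / 2), [set e : R | e < d / 2]).
    split => /=; first by apply: nbhsx_ballx; rewrite divr_gt0.
    by apply: nbhs_right_lt; rewrite divr_gt0.
  move=> [a' e] /= [aa' ed]; exists [set x | `|x - (G a - w)| < r]; split.
  - exact: convex_ball.
  - by rewrite /= sub0r normrN ltxx.
  - move=> b ba' /=.
    have -> : G b - w - (G a - w) = G b - G a by rewrite opprB addrA subrK.
    rewrite distrC; apply: ad.
    move: aa'; rewrite -!ball_normE /= => aa'.
    rewrite -(subrK a' a) -addrA.
    apply: le_lt_trans (ler_normD _ _) _.
    by rewrite (distrC a' b); lra.
move=> e /= e0 H; exists (e / 2); first by rewrite divr_gt0.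
move=> a a1 a2; apply: (H (e / 2)) => //=.
- by rewrite sub0r normrN gtr0_norm ?divr_gt0 //; lra.
by rewrite divr_gt0.
Qed.

Lemma near_segment_in (E : set (R * R)) p : open E -> E p ->
  \forall q \near p, segment_in E p q.
Proof.
move=> oE Ep; have : nbhs p E by exact: open_nbhs_nbhs.
move=> /nbhs_normP[r /= r0 rE].
apply/nbhs_normP; exists r => //= q /= pq s s01; apply: rE => /=.
rewrite distrC; apply: (@convex_ball p r p q s) => //=.
- by rewrite subrr normr0.
- by rewrite distrC.
Qed.

Variables (Omega : set (R * R)) (w : R * R).

Fixpoint chain p (l : seq (R * R)) : Prop :=
  if l is q :: l' then segment_in Omega p q /\ chain q l' else True.

Fixpoint chain_ang p (l : seq (R * R)) : R :=
  if l is q :: l' then ang (p - w) (q - w) + chain_ang q l' else 0.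

Lemma chain_cat p l1 l2 : chain p (l1 ++ l2) <-> chain p l1 /\ chain (last p l1) l2.
Proof.
elim: l1 p => [|q l1 IH] p /=; first by split => // -[].
by rewrite IH; tauto.
Qed.

Lemma chain_ang_cat p l1 l2 :
  chain_ang p (l1 ++ l2) = chain_ang p l1 + chain_ang (last p l1) l2.
Proof. by elim: l1 p => [|q l1 IH] p /=; rewrite ?add0r // IH addrA. Qed.

Lemma segment_inC p q : segment_in Omega p q -> segment_in Omega q p.
Proof.
move=> pq s /andP[s0 s1]; rewrite lin_rev; apply: pq.
by apply/andP; split; lra.
Qed.

Lemma chain_rev p l : chain p l -> exists l', [/\ chain (last p l) l',
  last (last p l) l' = p & chain_ang (last p l) l' = - chain_ang p l].
Proof.
elim: l p => [|q l IH] p /=; first by move=> _; exists [::]; rewrite /= oppr0.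
move=> [pq /IH[l' [h1 h2 h3]]]; exists (l' ++ [:: p]); split.
- by apply/chain_cat; split => //=; rewrite h2; split => //; exact: segment_inC.
- by rewrite last_cat.
- by rewrite chain_ang_cat h3 h2 /= angC; ring.
Qed.

Lemma chain_nth p l k : chain p l -> (k < size l)%N ->
  segment_in Omega (nth p (p :: l) k) (nth p (p :: l) k.+1).
Proof.
elim: l p k => // q l IH p [|k] [pq ql] kl //=.
have := IH q k ql kl; rewrite /= (set_nth_default q) ?(set_nth_default q p) //=.
by rewrite ltnS ltnW.
Qed.

Lemma chain_angE p l :
  chain_ang p l = \sum_(k < size l) ang (nth p (p :: l) k - w) (nth p (p :: l) k.+1 - w).
Proof.
elim: l p => [|q l IH] p; first by rewrite big_ord0.
rewrite /= big_ord_recl /= IH; congr (_ + _); apply: eq_bigr => k _.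
by rewrite /= add0n (set_nth_default p q) //= ?ltnS 1?ltnW // (set_nth_default p q).
Qed.

Lemma sum_blocks (f : nat -> R) n m :
  \sum_(i < n * m) f i = \sum_(k < n) \sum_(l < m) f (k * m + l)%N.
Proof.
elim: n => [|n IH]; first by rewrite mul0n !big_ord0.
rewrite big_ord_recr /= -IH mulSn addnC.
rewrite -!(big_mkord xpredT) (@big_cat_nat _ _ _ (n * m)) ?leq_addr //=.
congr (_ + _); rewrite -{1}[(n * m)%N]add0n big_addn addKn.
by rewrite big_mkord; apply: eq_bigr => l _; rewrite addnC.
Qed.

Hypothesis Omega_sc : simply_connected R Omega.
Hypothesis Omega_w : ~ Omega w.

(** Parametrise the closed polygon as a loop, contract it in [Omega], and sample the homotopy on a
    grid so fine that each cell is mapped into a convex set missing [w]. The bottom row of the grid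
    then has total angle 0 by [ang_grid_sum], and that row subdivides the polygon. *)
Lemma closed_chain_ang p l : chain p l -> last p l = p -> chain_ang p l = 0.
Proof.
move=> cpl lpl; pose n := size l.
case: (posnP n) => [n0|n0]; first by move: n0; rewrite /n; case: (l).
pose P k := nth p (p :: l) k.
have P0 : P 0%N = p by [].
have Pn : P n = p by rewrite /P -[RHS]lpl (last_nth p).
have Pseg k : (k < n)%N -> segment_in Omega (P k) (P k.+1) by exact: chain_nth.
pose g s : R * R := (polyline (fun k => (P k).1) n (s * n%:R),
                     polyline (fun k => (P k).2) n (s * n%:R)).
have gE k s : (k < n)%N -> k%:R <= s * n%:R <= k.+1%:R ->
    g s = lin (s * n%:R - k%:R) (P k) (P k.+1).
  by move=> kn ks; rewrite /g !(@polylineE _ n k).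
have nr : 0 < n%:R :> R by rewrite ltr0n.
have gO s : 0 <= s <= 1 -> Omega (g s).
  move=> /andP[s0 s1].
  have [|k kn ks] := @unit_interval_index n (s * n%:R) n0.
    by rewrite mulr_ge0 ?(ltW nr) //= -[X in _ <= X]mul1r ler_wpM2r // ltW.
  rewrite (gE k) //; apply: Pseg => //.
  move: ks; rewrite -natr1 => /andP[? ?]; apply/andP; split; lra.
have g0 : g 0 = p.
  rewrite (gE 0%N) // mul0r ?subrr ?lin0 // lexx; exact: ler01.
have g1 : g 1 = p.
  have nE : n.-1.+1 = n by rewrite prednK.
  rewrite (gE n.-1) ?nE // mul1r ?lexx ?ler_nat ?leq_pred //.
  have -> : n%:R - n.-1%:R = 1 :> R by rewrite -{1}nE -natr1; ring.
  by rewrite lin1 Pn.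
have cg : continuous g.
  by move=> s; apply: cvg_mkpair; apply: (@cvg_comp _ _ _ (fun s : R => s * n%:R) (polyline _ n));
   [apply: cvgM; [exact: cvg_id|exact: cvg_cst]|exact: continuous_polyline|
    apply: cvgM; [exact: cvg_id|exact: cvg_cst]|exact: continuous_polyline].
have loop_g : loop_in Omega g.
  split; last by rewrite g0 g1.
  - exact: continuous_subspaceT.
  - by move=> x [s /=]; rewrite in_itv /= => /gO + <-.
have [H [cH HO Hbot Htop Hside]] := Omega_sc.2 g loop_g.
(* Precomposing with the retraction onto the unit square makes the homotopy continuous on the whole
   plane. *)
pose c (x : R * R) := (clamp01 x.1, clamp01 x.2).
have cA x : (`[0 : R, 1]%classic `*` `[0 : R, 1]%classic) (c x).
  by split; rewrite /= in_itv /= clamp01_itv.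
have cc : continuous c.
  move=> x; apply: cvg_mkpair;
  apply: (@cvg_comp _ _ _ _ clamp01); do ?[exact: continuous_clamp01].
  - exact: cvg_fst.
  - exact: cvg_snd.
have cHc : continuous (H \o c) by exact: within_continuous_comp cH.
have Hcw a : (H \o c) a <> w.
  by move=> e; apply: Omega_w; rewrite -e; apply: HO; exists (c a).
have [e e0 He] := uniform_cells cHc Hcw.
have [m m0 me] : exists2 m : nat, (0 < m)%N & m%:R^-1 < e.
  exists (Num.truncn e^-1).+1 => //.
  rewrite invf_plt ?posrE ?ltr0n //.
  exact: truncnS_gt.
have mr : 0 < m%:R :> R by rewrite ltr0n.
(* A multiple of the number [n] of edges, so that the polygon's vertices are among the grid points
   and each edge is cut into [m] equal pieces. *)
pose N := (n * m)%N.
have N0 : 0 < N%:R :> R by rewrite ltr0n muln_gt0 n0.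
have Nn : N%:R != 0 :> R by rewrite gt_eqF.
have NI i : (i <= N)%N -> 0 <= (i%:R / N%:R : R) <= 1.
  by move=> iN; rewrite divr_ge0 //= ler_pdivrMr // mul1r ler_nat.
pose h (i j : nat) := H (i%:R / N%:R, j%:R / N%:R) - w.
have hE i j : (i <= N)%N -> (j <= N)%N -> h i j = (H \o c) (i%:R / N%:R, j%:R / N%:R) - w.
  by move=> iN jN; rewrite /h /= /c /= !clamp01_id ?NI.
have dN : N%:R^-1 < e.
  apply: le_lt_trans me; rewrite lef_pV2 ?posrE // ler_nat.
  by rewrite leq_pmull.
have nearS i : `|(i.+1%:R / N%:R : R) - i%:R / N%:R| < e.
  by rewrite -mulrBl -natr1 addrAC subrr add0r mul1r ger0_norm // invr_ge0 ltW.
have : \sum_(i < N) ang (h i 0%N) (h i.+1 0%N) = 0.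
  apply: ang_grid_sum.
  - move=> i j iN jN.
    have [K [cK K0 KH]] := He (i%:R / N%:R, j%:R / N%:R) (NI i (ltnW iN)) (NI j (ltnW jN)).
    exists K; rewrite !hE //; try exact: ltnW.
    have KB i' j' : `|(i'%:R / N%:R : R) - i%:R / N%:R| < e ->
        `|(j'%:R / N%:R : R) - j%:R / N%:R| < e ->
        K ((H \o c) (i'%:R / N%:R, j'%:R / N%:R) - w).
      by move=> bi bj; apply: KH; rewrite pair_norm_lt /= bi bj.
    have r0 (i' : nat) : `|(i'%:R / N%:R : R) - i'%:R / N%:R| < e.
      by rewrite subrr normr0.
    by split=> //; split; apply: KB; do ?[exact: r0|exact: nearS].
  - move=> j jN; rewrite /h mul0r divff //.
    by have [-> ->] := Hside _ (NI _ jN).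
  - by move=> i iN; rewrite /h divff // !Htop ?NI // ltnW.
move=> <-; rewrite chain_angE -/n (sum_blocks (fun i => ang (h i 0%N) (h i.+1 0%N))).
apply: eq_bigr => k _.
rewrite -(@ang_subdivide _ _ m) //; last first.
  move=> s s01; rewrite -linB => /eqP; rewrite subr_eq0 => /eqP sE.
  by apply: Omega_w; rewrite -sE; exact: Pseg.
have hk j : (j <= m)%N -> h (k * m + j)%N 0%N = lin (j%:R / m%:R) (P k - w) (P k.+1 - w).
  move=> jm; rewrite /h mul0r -linB.
  have jr : j%:R <= m%:R :> R by rewrite ler_nat.
  have E : (k * m + j)%:R / N%:R * n%:R = k%:R + j%:R / m%:R :> R.
    by rewrite /N natrD !natrM; field; rewrite !gt_eqF.
  have kN : (k * m + j <= N)%N.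
    by rewrite /N (leq_trans (leq_add (leqnn _) jm)) // addnC -mulSn leq_mul2r ltn_ord orbT.
  rewrite Hbot ?NI // (gE k) // E; last first.
    by rewrite lerDl divr_ge0 //= -natr1 lerD2l ler_pdivrMr // mul1r.
  by rewrite addrAC subrr add0r.
by apply: eq_bigr => j _; rewrite -addnS !hk // ltnW.
Qed.

(** Since closed polygons have total angle 0, summing the angles around [w] along any polygon from a
    base point gives a potential; connectedness supplies a polygon to every point of [Omega]. *)
Lemma angle_function : open Omega -> connected Omega ->
  exists theta : R * R -> R, forall p q, segment_in Omega p q ->
    theta q - theta p = ang (p - w) (q - w).
Proof.
move=> oO cO.
have [[x0 x0O]|O0] := pselect (Omega !=set0); last first.
  exists (fun=> 0) => p q /(_ 0); rewrite lexx ler01 => /(_ isT) pO.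
  by case: O0; exists (lin 0 p q).
have ball_seg := near_segment_in oO.
have ex y : Omega y -> exists l, chain x0 l /\ last x0 l = y.
  move=> Oy; pose f y := exists l, chain x0 l /\ last x0 l = y.
  suff fE : f x0 = f y by rewrite -/(f y) -fE; exists [::].
  apply: (connected_locally_constant cO) => // x Ox; rewrite /f.
  have := ball_seg _ Ox; apply: filterS => z xz Oz.
  apply/propext; split => -[l [cl ll]].
    exists (l ++ [:: x]); rewrite last_cat /=; split => //.
    by apply/chain_cat; rewrite ll /=; split => //; split => //; exact: segment_inC.
  exists (l ++ [:: z]); rewrite last_cat /=; split => //.
  by apply/chain_cat; rewrite ll /=.
have /choice[L LP] : forall y, exists l, Omega y -> chain x0 l /\ last x0 l = y.
  move=> y; have [Oy|nOy] := pselect (Omega y); last by exists [::].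
  by have [l ?] := ex _ Oy; exists l.
exists (fun y => chain_ang x0 (L y)) => p q pq.
have Op : Omega p by have := pq 0; rewrite lin0; apply; rewrite lexx ler01.
have Oq : Omega q by have := pq 1; rewrite lin1; apply; rewrite lexx ler01.
have [cp lp] := LP _ Op; have [cq lq] := LP _ Oq.
have [l' []] := chain_rev cq; rewrite lq => h1 h2 h3.
(* The chain to [p], the segment to [q] and the reversed chain to [q] close up at [x0]. *)
have cpq : chain x0 (L p ++ q :: l') by apply/chain_cat; rewrite lp.
have := closed_chain_ang cpq.
by rewrite last_cat chain_ang_cat /= lp h2 h3 => /(_ erefl); lra.
Qed.

End Winding.

                                        

(** * Moving the viewpoint of an angle function; sup-norm geometry *)

Section Planar.
Variable R : realType.
Implicit Types (p q w : R * R) (s t : R) (C Omega : set (R * R)).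

Lemma angNN p q : ang (- p) (- q) = ang p q.
Proof. by rewrite /ang /enorm /cross /dot /= !mulrNN. Qed.

Lemma nonoppNN p q : nonopp (- p) (- q) = nonopp p q.
Proof. by rewrite /nonopp /enorm /dot /= !mulrNN. Qed.

                                                                         
Definition vang o p q := ang (p - o) (q - o).

Lemma vangC o p q : vang o q p = - vang o p q.
Proof. exact: angC. Qed.

Lemma vangN o p q : vang o p q = ang (o - p) (o - q).
Proof. by rewrite /vang -angNN !opprB. Qed.

Lemma vang_add (K : set (R * R)) o p q r : convex_pl K -> ~ K o ->
  K p -> K q -> K r -> vang o p q + vang o q r = vang o p r.
Proof.
move=> cK K0 Kp Kq Kr; apply: (@ang_add _ [set x | K (x + o)]);
  rewrite /= ?add0r ?subrK //; exact: convex_shift.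
Qed.

Lemma vang_triangle o p q r :
  (forall s u, 0 <= s <= 1 -> 0 <= u <= 1 -> lin s p (lin u q r) <> o) ->
  vang o p q + vang o q r = vang o p r.
Proof.
move=> H; apply/eqP; rewrite -subr_eq0 -(angC (p - o)); apply/eqP.
apply: ang_cocycle_triangle => s u s01 u01; rewrite -!linB => /eqP.
by rewrite subr_eq0 => /eqP; exact: H.
Qed.

Lemma nonopp_vang o p q : (forall s, 0 <= s <= 1 -> lin s p q <> o) ->
  nonopp (p - o) (q - o).
Proof.
move=> H; apply: nonopp_lin => s s01; rewrite -linB => /eqP.
by rewrite subr_eq0 => /eqP; exact: H.
Qed.

Lemma nonopp_vang_convex (K : set (R * R)) o p q : convex_pl K -> ~ K o ->
  K p -> K q -> nonopp (p - o) (q - o).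
Proof.
move=> cK K0 Kp Kq; apply: nonopp_vang => s s01 e.
by apply: K0; rewrite -e; exact: cK.
Qed.

Lemma polar_inj p s t : polar p s -> polar p t -> congr2pi s t.
Proof.
move=> ps pt; have := ang_congr (nonopp_pp (polar_neq0 ps)) pt ps.
rewrite ang_pp => -[k /eqP]; rewrite eq_sym addr_eq0 subr_eq => /eqP ->.
by exists (- k); rewrite mulrNz addrC.
Qed.

                                                                           
                                                                
Definition angle_fun Omega w (th : R * R -> R) :=
  forall p q, segment_in Omega p q -> th q - th p = vang w p q.

                                                                               
                                                                     
(** On [C] the function [th' p - th p - vang p w w'] is locally constant. Its increment [D y] from a
    nearby point [x] is continuous, vanishes at [x], and is a multiple of 2 pi, as polar arguments
    show. The last term does not jump because the segment from [w] to [w'] lies in [K], which [C]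
    avoids. *)
Lemma angle_fun_diff Omega w w' th th' C (K : set (R * R)) x y : open Omega ->
  angle_fun Omega w th -> angle_fun Omega w' th' ->
  ~ Omega w -> ~ Omega w' -> convex_pl K -> K w -> K w' ->
  connected C -> C `<=` Omega -> (forall p, C p -> ~ K p) -> C x -> C y ->
  (th' y - th' x) - (th y - th x) = vang y w w' - vang x w w'.
Proof.
move=> oO thw thw' Ow Ow' cK Kw Kw' cC CO CK Cx Cy.
pose f p := th' p - th p - vang p w w'.
suff : f x = f y by rewrite /f; lra.
apply: (connected_locally_constant cC) => // {}x {}Cx {y Cy}.
have xw : x - w != 0 by rewrite subr_eq0; apply/eqP => e; apply: Ow; rewrite -e; exact: CO.
have xw' : x - w' != 0 by rewrite subr_eq0; apply/eqP => e; apply: Ow'; rewrite -e; exact: CO.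
have nxw : nonopp (x - w) (x - w) by exact: nonopp_pp.
have nxw' : nonopp (x - w') (x - w') by exact: nonopp_pp.
have nx : nonopp (w - x) (w' - x) by exact: (nonopp_vang_convex cK (CK _ Cx)).
pose D y := vang w' x y - vang w x y - (vang y w w' - vang x w w').
have cB (a : R * R) : y - a @[y --> x] --> x - a.
  by apply: cvgB; [exact: cvg_id|exact: cvg_cst].
have cBr (a : R * R) : a - y @[y --> x] --> a - x.
  by apply: cvgB; [exact: cvg_cst|exact: cvg_id].
have cD : D y @[y --> x] --> D x.
  apply: cvgB; first by apply: cvgB; apply: cvg_ang => //; exact: cvg_cst.
  apply: cvgB; last exact: cvg_cst.
  exact: cvg_ang.
have D0 : D x = 0 by rewrite /D /vang !ang_pp !subrr.
have := near_segment_in oO (CO _ Cx).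
have /cvgr_distC_lt /(_ pi (@pi_gt0 R)) := cD.
have N : \forall y \near x, nonopp (x - w) (y - w) /\ nonopp (x - w') (y - w').
  apply: filterI.
    exact: (near_nonopp (cvg_cst (x - w)) (cB w) nxw).
  exact: (near_nonopp (cvg_cst (x - w')) (cB w') nxw').
move: N; apply: filterS3 => y [ny ny']; rewrite D0 => Dy seg Cy.
have nyw : nonopp (w - y) (w' - y) by exact: (nonopp_vang_convex cK (CK _ Cy)).
suff : D y = 0.
  rewrite /D /f; have := thw _ _ seg; have := thw' _ _ seg; lra.
apply: congr2pi_near0 => //.
have /andP[_ yw] := nonopp_neq0 ny; have /andP[_ yw'] := nonopp_neq0 ny'.
have [[s xs] [s' ys]] := (polar_ex xw, polar_ex yw).
have [[t xt] [t' yt]] := (polar_ex xw', polar_ex yw').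
(* Zero is split so that each of the four angles in [D y] is matched with a difference of polar
   arguments. *)
have -> : 0 = (t' - t) - (s' - s) - ((t' - s') - (t - s)) :> R by ring.
rewrite /D !(vangN _ w w'); apply: congr2piB; apply: congr2piB; apply: ang_congr => //;
  by rewrite -nonoppNN !opprB.
Qed.

Lemma connected_segment p q : connected [set x | exists2 s, 0 <= s <= 1 & x = lin s p q].
Proof.
have -> : [set x | exists2 s, 0 <= s <= 1 & x = lin s p q] =
    (fun s => lin s p q) @` `[0, 1].
  by apply/seteqP; split => x [s s01 e]; exists s => //=; move: s01; rewrite /= in_itv.
apply: connected_continuous_connected; first exact: segment_connected.
apply: continuous_subspaceT => s.
by apply: cvg_lin; [exact: cvg_id|exact: cvg_cst|exact: cvg_cst].
Qed.

(** [C] may come arbitrarily close to the closed ball. Joining [x] to [y] by finitely many short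
    segments near points of [C] leaves a positive margin; the points reachable in this way from [x]
    form a relatively open and closed part of [C]. *)
Lemma connected_shrink Omega C z (r : R) x y : open Omega -> connected C ->
  C `<=` Omega -> (forall p, C p -> r < `|p - z|) -> C x -> C y ->
  exists C' (e : R), [/\ connected C', 0 < e, C' `<=` Omega,
    forall p, C' p -> r + e < `|p - z| & C' x /\ C' y].
Proof.
move=> oO cC CO Cr Cx Cy.
pose f y := exists C' (e : R), [/\ connected C', 0 < e, C' `<=` Omega,
    forall p, C' p -> r + e < `|p - z| & C' x /\ C' y].
have seg (a : R * R) : C a -> \forall b \near a, exists e : R,
   [/\ 0 < e, segment_in Omega a b &
    forall s, 0 <= s <= 1 -> r + e < `|lin s a b - z|].
  move=> Ca; have := near_segment_in oO (CO _ Ca).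
  (* With a third of the gap, points within [e] of [a] are still at distance more than [r + e] from
     [z]. *)
  pose e := (`|a - z| - r) / 3.
  have e0 : 0 < e by rewrite divr_gt0 // subr_gt0 Cr.
  have : \forall b \near a, `|b - a| < e.
    by apply/nbhs_normP; exists e => //= b; rewrite /= distrC.
  apply: filterS2 => b ba ab; exists e; split => // s s01.
  have : `|lin s a b - a| < e.
    by apply: (@convex_ball _ a e) => //=; rewrite subrr normr0.
  have := ler_distD (lin s a b) a z; rewrite (distrC a (lin s a b)).
  have : e * 3 = `|a - z| - r by rewrite /e divfK.
  lra.
have glue (a b : R * R) : (exists e : R, [/\ 0 < e, segment_in Omega a b &
    forall s, 0 <= s <= 1 -> r + e < `|lin s a b - z|]) -> f a -> f b.
  move=> [e [e0 ab Hab]] [C' [e' [cC' e'0 C'O C'r [C'x C'a]]]].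
  exists (C' `|` [set x | exists2 s, 0 <= s <= 1 & x = lin s a b]), (Num.min e e').
  have a0 : [set x | exists2 s, 0 <= s <= 1 & x = lin s a b] a.
    by exists 0; rewrite ?lin0 // lexx ler01.
  split.
  - by apply: connectedU => //; [exists a|exact: connected_segment].
  - by rewrite lt_min e0.
  - by move=> p [/C'O //|[s s01 ->]]; exact: ab.
  - move=> p [/C'r|[s s01 ->]].
      by apply: le_lt_trans; rewrite lerD2l ge_min lexx orbT.
    by apply: le_lt_trans (Hab _ s01); rewrite lerD2l ge_min lexx.
  - by split; [left|right; exists 1; rewrite ?lin1 // lexx ler01].
suff fE : f x = f y.
  rewrite -/(f y) -fE; exists [set x], ((`|x - z| - r) / 2).
  have := Cr _ Cx => xr; split => //; [exact: connected1|lra|by move=> p ->; exact: CO|].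
  by move=> p ->; lra.
apply: (connected_locally_constant cC) => // a Ca.
apply: filterS (seg _ Ca) => b [e [e0 ab Hab]] Cb; apply/propext; split; apply: glue.
  exists e; split => //; first exact: segment_inC.
  move=> s /andP[s0 s1]; rewrite lin_rev; apply: Hab.
  by apply/andP; split; lra.
by exists e.
Qed.

Lemma compact_closed_ball2 z (r : R) : compact [set x : R * R | `|x - z| <= r].
Proof.
have -> : [set x : R * R | `|x - z| <= r] =
    (`[z.1 - r, z.1 + r]%classic `*` `[z.2 - r, z.2 + r]%classic).
  apply/seteqP; split => x /=; rewrite !in_itv /= pair_norm_le !ler_norml /=.
    by move=> /andP[/andP[? ?] /andP[? ?]]; split; apply/andP; split; lra.
  by move=> [/andP[? ?] /andP[? ?]]; apply/andP; split; apply/andP; split; lra.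
by apply: compact_setX; exact: segment_compact.
Qed.

Lemma nearest_point (E : set (R * R)) z : closed E -> E !=set0 ->
  exists2 w, E w & forall x, E x -> `|z - w| <= `|z - x|.
Proof.
move=> cE [x0 Ex0]; pose K := [set x : R * R | `|x - z| <= `|x0 - z|] `&` E.
have cK : compact K by apply: compact_closedI => //; exact: compact_closed_ball2.
have K0 : K !=set0 by exists x0; split => //=.
have cd : {within K, continuous (fun x : R * R => `|z - x|)}.
  apply: continuous_subspaceT => x; apply: cvg_norm.
  by apply: cvgB; [exact: cvg_cst|exact: cvg_id].
have [w /set_mem[wz Ew] wmin] := compact_EVT_min K0 cK cd.
exists w => // x Ex; have [xx0|xx0] := leP `|x - z| `|x0 - z|.
  by apply: wmin; apply/mem_set; split.
by rewrite distrC (distrC z); exact: le_trans wz (ltW xx0).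
Qed.

(** The part of the segment outside the ball about [c] has length at most the excess of [m] over
    [h], so the hypothesis puts that part in the ball about [z]; a point outside both balls cannot
    be on the segment. *)
Lemma lin_two_balls (c m z o : R * R) (h r s : R) : 0 <= h -> 0 <= s <= 1 ->
  `|m - c| - h + `|m - z| <= r -> h < `|o - c| -> r < `|o - z| -> lin s c m <> o.
Proof.
move=> h0 s01 mr + + oE; rewrite -{}oE => oc oz.
have e1 : `|lin s c m - c| <= s * `|m - c|.
  rewrite linB; apply: le_trans (norm_lin_le s01 (lexx _) (lexx _)) _.
  by rewrite subrr normr0 mulr0 add0r.
have e2 : `|lin s c m - m| <= (1 - s) * `|m - c|.
  rewrite linB; apply: le_trans (norm_lin_le s01 (lexx _) (lexx _)) _.
  by rewrite subrr normr0 mulr0 addr0 distrC.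
have := ler_distD m (lin s c m) z; lra.
Qed.

(** The point of the boundary of the sup-norm unit square in direction [t]: sizes are measured in
    the sup norm, directions by Euclidean angle. *)
Definition unit_dir t : R * R := `|(cos t, sin t)|^-1 *: (cos t, sin t).

Lemma cossin_neq0 t : (cos t, sin t) != 0 :> R * R.
Proof.
by apply: (@polar_neq0 _ _ t); exists 1 => //; rewrite !mul1r.
Qed.

Lemma cossin_gt0 t : 0 < `|(cos t, sin t) : R * R|.
Proof. by rewrite normr_gt0 cossin_neq0. Qed.

Lemma norm_unit_dir t : `|unit_dir t| = 1.
Proof.
rewrite normrZ ger0_norm ?invr_ge0 // mulVf // normr_eq0.
exact: cossin_neq0.
Qed.

Lemma polar_unit_dir (r : R) t : 0 < r -> polar (r *: unit_dir t) t.
Proof.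
move=> r0; exists (r * `|(cos t, sin t) : R * R|^-1).
  by rewrite mulr_gt0 // invr_gt0 cossin_gt0.
by rewrite /unit_dir scalerA.
Qed.

Lemma continuous_unit_dir : continuous unit_dir.
Proof.
move=> t.
have ccs : (cos s, sin s) @[s --> t] --> ((cos t, sin t) : R * R).
  by apply: cvg_mkpair; [exact: continuous_cos|exact: continuous_sin].
apply: cvgZ => //; apply: cvgV; first by rewrite gt_eqF // cossin_gt0.
exact: cvg_norm.
Qed.

Lemma unit_dir_ex (x : R * R) : x != 0 -> exists t, x = `|x| *: unit_dir t.
Proof.
move=> /polar_ex[t [r r0 xE]]; exists t.
have xE' : x = r *: (cos t, sin t) by rewrite xE.
rewrite {2}xE' normrZ (gtr0_norm r0) /unit_dir scalerA -mulrA mulfV ?mulr1 //.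
by rewrite gt_eqF // cossin_gt0.
Qed.

Lemma unit_dir_congr s t : congr2pi s t -> unit_dir s = unit_dir t.
Proof. by move=> st; rewrite /unit_dir (cos_congr2pi st) (sin_congr2pi st). Qed.

Lemma unit_dir_inj s t : unit_dir s = unit_dir t -> congr2pi s t.
Proof.
move=> e; have h u := @polar_unit_dir 1 u ltr01.
by apply: (polar_inj (h s)); rewrite e; exact: h.
Qed.

Lemma unit_dirDpi t : unit_dir (t + pi) = - unit_dir t.
Proof.
rewrite /unit_dir cosDpi sinDpi.
have -> : (- cos t, - sin t) = - (cos t, sin t) by [].
by rewrite normrN scalerN.
Qed.

End Planar.

                                

(** * Rays from the centre, and triangle angle sums with a tracked branch *)

Section Rays.
Variables (R : realType) (c : R * R).
Implicit Types (r s t h : R) (x y p q v : R * R).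

Definition ray r t : R * R := c + r *: unit_dir t.

Lemma rayB r t : ray r t - c = r *: unit_dir t.
Proof. by rewrite /ray addrAC subrr add0r. Qed.

Lemma norm_rayB r t : `|ray r t - c| = `|r|.
Proof. by rewrite rayB normrZ norm_unit_dir mulr1. Qed.

Lemma norm_ray_ray r s t : `|ray r t - ray s t| = `|r - s|.
Proof.
rewrite /ray opprD addrACA subrr add0r -scalerBl normrZ norm_unit_dir.
by rewrite mulr1.
Qed.

Lemma ray_ex x : x != c -> exists t, x = ray `|x - c| t.
Proof.
rewrite -subr_eq0 => /unit_dir_ex[t xE]; exists t.
by rewrite /ray -xE addrC subrK.
Qed.

Lemma vang_ray r r' s t : 0 < r -> 0 < r' -> `|t - s| < pi ->
  vang c (ray r s) (ray r' t) = t - s.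
Proof.
move=> r0 r'0 ts; rewrite /vang !rayB.
by apply: ang_polar_eq => //; exact: polar_unit_dir.
Qed.

Lemma lin_ray s r t : lin s c (ray r t) = ray (s * r) t.
Proof. by rewrite /lin /ray /=; congr pair => /=; rewrite /GRing.scale /=; ring. Qed.

Lemma continuous_ray : continuous (fun z : R * R => ray z.2 z.1).
Proof.
move=> z; apply: cvgD; first exact: cvg_cst.
apply: cvgZ; first exact: cvg_snd.
apply: (@cvg_comp _ _ _ fst (@unit_dir R)); first exact: cvg_fst.
exact: continuous_unit_dir.
Qed.

Lemma continuous_ray_dir r : continuous (ray r).
Proof.
move=> t; apply: cvgD; first exact: cvg_cst.
by apply: cvgZ; [exact: cvg_cst|exact: continuous_unit_dir].
Qed.

Section Triangle.
Variables (h rv tv : R).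
Hypotheses (h0 : 0 < h) (rv_h : h < rv).
Local Notation v := (ray rv tv).
Local Notation q := (ray h).

(** The signed angles at [q t] and at [v] of the triangle with vertices [c], [v], [q t], plus [t].
    As the angle at [c] is [t - tv] up to full turns, the angle sum makes this [tv + pi] or
    [tv - pi], according to the side. *)
Definition base_angles t := vang (q t) c v - vang v c (q t) + t.
Local Notation G := base_angles.

Let rv0 : 0 < rv. Proof. exact: lt_trans h0 rv_h. Qed.

Lemma ray_notin_segment t : ~ congr2pi t tv -> forall s, 0 <= s <= 1 -> lin s c v <> q t.
Proof.
move=> ttv s /andP[s0 s1]; rewrite lin_ray => e.
have : s * rv = h.
  have := congr1 (fun x => `|x - c|) e; rewrite !norm_rayB !ger0_norm ?(ltW h0) //.
  by rewrite mulr_ge0 // ltW.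
move=> sE; apply: ttv; apply: unit_dir_inj.
move: e; rewrite sE /ray => /addrI /scalerI -> //.
by rewrite gt_eqF.
Qed.

Lemma apex_notin_segment t s : 0 <= s <= 1 -> lin s c (q t) <> v.
Proof.
move=> /andP[s0 s1]; rewrite lin_ray => /(congr1 (fun x => `|x - c|)).
rewrite !norm_rayB (gtr0_norm rv0) ger0_norm; last by rewrite mulr_ge0 // ltW.
by move: h0 rv_h => ? ? ?; nra.
Qed.

Lemma triangle_cvg t : ~ congr2pi t tv -> G s @[s --> t] --> G t.
Proof.
move=> ttv; apply: cvgD; last exact: cvg_id.
apply: cvgB; apply: cvg_ang.
- by apply: cvgB; [exact: cvg_cst|exact: continuous_ray_dir].
- by apply: cvgB; [exact: cvg_cst|exact: continuous_ray_dir].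
- by apply: nonopp_vang; exact: ray_notin_segment.
- exact: cvg_cst.
- by apply: cvgB; [exact: continuous_ray_dir|exact: cvg_cst].
- by apply: nonopp_vang => s; exact: apex_notin_segment.
Qed.

Lemma triangle_congr t : ~ congr2pi t tv -> congr2pi (G t) (tv - pi).
Proof.
move=> ttv; rewrite /G vangC (vangN v) /vang.
have n1 : nonopp (c - q t) (v - q t) by apply: nonopp_vang; exact: ray_notin_segment.
have n2 : nonopp (q t - v) (c - v).
  by apply: nonoppC; apply: nonopp_vang => s; exact: apex_notin_segment.
have n2' : nonopp (v - c) (v - q t) by rewrite -nonoppNN !opprB; exact: nonoppC.
have /andP[_ /polar_ex[a va]] := nonopp_neq0 n1.
have pv : polar (v - c) tv by rewrite rayB; exact: polar_unit_dir.
have pq : polar (c - q t) (t + pi).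
  by rewrite -opprB; apply: polarN; rewrite rayB; exact: polar_unit_dir.
have -> : tv - pi = - (t + pi - a) - (a - tv) + t by ring.
apply: congr2piD; last exact: congr2pi_refl.
apply: congr2piB; last exact: ang_congr n2' _ va.
by apply: congr2piN; apply: ang_congr => //; exact: nonoppC.
Qed.

Lemma triangle_const (I : set R) s t : is_interval I ->
  (forall u, I u -> ~ congr2pi u tv) -> I s -> I t -> G s = G t.
Proof.
move=> iI Itv; apply: (@continuous_congr_const _ I G (tv - pi) iI) => // u /Itv utv.
  exact: triangle_cvg.
exact: triangle_congr.
Qed.

(** Here [c] lies between [v] and [q t]: the triangle is flat and both base angles vanish. This
    anchors the constants on either side of the ray to [v]. *)
Lemma triangle_opposite t : unit_dir t = - unit_dir tv -> G t = t.
Proof.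
move=> e.
have qE : q t = c - h *: unit_dir tv by rewrite /ray e scalerN.
have z r r' : 0 < r -> 0 < r' -> ang (r *: unit_dir tv) (r' *: unit_dir tv) = 0.
  move=> r0 r'0; rewrite -(subrr tv); apply: ang_polar_eq; try exact: polar_unit_dir.
  by rewrite subrr normr0 pi_gt0.
rewrite /G (vangN v) /vang qE opprB.
have -> : c + (h *: unit_dir tv - c) = h *: unit_dir tv by rewrite addrC subrK.
have -> : v + (h *: unit_dir tv - c) = (rv + h) *: unit_dir tv.
  by rewrite addrC /ray addrA subrK addrC -scalerDl.
have -> : v - c = rv *: unit_dir tv by rewrite rayB.
by rewrite !z ?addr_gt0 // subrr add0r.
Qed.

Lemma not_congr2pi_itv t : t != tv -> `|t - tv| < pi *+ 2 -> ~ congr2pi t tv.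
Proof. by move=> ttv tpi /congr2pi0_eq /(_ tpi) /eqP; exact/negP. Qed.

                                                                  
(** The triangle can degenerate badly only when [q t] lies on the segment from [c] to [v], that is
    for [t] congruent to [tv]. Between two such values the sum is constant, and the flat case
    [tv + pi] evaluates it. *)
Lemma triangle_right t : tv < t < tv + pi *+ 2 -> G t = tv + pi.
Proof.
move=> tt; have pi0 := @pi_gt0 R.
rewrite -(@triangle_opposite (tv + pi)) ?unit_dirDpi //.
apply: (@triangle_const [set` `]tv, tv + pi *+ 2[]).
- exact: interval_is_interval.
- move=> u; rewrite /= in_itv /= => /andP[u1 u2]; apply: not_congr2pi_itv.
    by rewrite gt_eqF.
  by rewrite gtr0_norm; lra.
- by rewrite /= in_itv.
- by rewrite /= in_itv /=; apply/andP; split; lra.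
Qed.

Lemma triangle_left t : tv - pi *+ 2 < t < tv -> G t = tv - pi.
Proof.
move=> tt; have pi0 := @pi_gt0 R.
rewrite -(@triangle_opposite (tv - pi)); last first.
  by rewrite -[in RHS](subrK pi tv) unit_dirDpi opprK.
apply: (@triangle_const [set` `]tv - pi *+ 2, tv[]).
- exact: interval_is_interval.
- move=> u; rewrite /= in_itv /= => /andP[u1 u2]; apply: not_congr2pi_itv.
    by rewrite lt_eqF.
  by rewrite ltr0_norm; lra.
- by rewrite /= in_itv.
- by rewrite /= in_itv /=; apply/andP; split; lra.
Qed.

End Triangle.
End Rays.

Lemma near_right_witness (R : realType) (a b : R) (P : R -> Prop) : a < b ->
  (\forall t \near a, P t) -> exists2 t, a < t < b & P t.
Proof.
move=> ab /nbhs_ballP[e /= e0 eP].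
have m0 : 0 < Num.min e (b - a) by rewrite lt_min e0 subr_gt0.
have me : Num.min e (b - a) <= e by rewrite ge_min lexx.
have mb : Num.min e (b - a) <= b - a by rewrite ge_min lexx orbT.
exists (a + Num.min e (b - a) / 2); first by apply/andP; split; lra.
apply: eP; rewrite -ball_normE /= opprD addrA subrr sub0r normrN gtr0_norm; lra.
Qed.

Lemma near_left_witness (R : realType) (a b : R) (P : R -> Prop) : a < b ->
  (\forall t \near b, P t) -> exists2 t, a < t < b & P t.
Proof.
move=> ab /nbhs_ballP[e /= e0 eP].
have m0 : 0 < Num.min e (b - a) by rewrite lt_min e0 subr_gt0.
have me : Num.min e (b - a) <= e by rewrite ge_min lexx.
have mb : Num.min e (b - a) <= b - a by rewrite ge_min lexx orbT.
exists (b - Num.min e (b - a) / 2); first by apply/andP; split; lra.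
apply: eP; rewrite -ball_normE /= opprB addrC subrK gtr0_norm; lra.
Qed.

                                               

(** * The family of touching squares and the invariant that yields the contradiction *)

Section Separation.
Variables (R : realType) (Omega : set (R * R)) (c B : R * R) (h : R).
Hypotheses (oO : open Omega) (cO : connected Omega).
Hypothesis (h0 : 0 < h).
Hypothesis (SO : forall x, `|x - c| < h -> Omega x).
Hypotheses (OB : Omega B) (Bh : h < `|B - c|).
Implicit Types (x y z p w : R * R) (r s t rho : R).

Local Notation q := (ray c h).

Lemma center_in : Omega c.
Proof. by apply: SO; rewrite subrr normr0. Qed.

Lemma near_dist (V : normedModType R) (y : V) (e : R) : 0 < e ->
  \forall z \near y, `|z - y| < e.
Proof. by move=> e0; apply/nbhs_normP; exists e => //= z; rewrite /= distrC. Qed.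

(** Beyond radius [h], the remaining part of the segment has length at most [|z - y|], so it stays
    within [e] of [y]. *)
Lemma segment_from_center y z (e : R) : (forall x, `|x - y| < e -> Omega x) ->
  `|y - c| <= h -> `|z - y| < e / 2 -> segment_in Omega c z.
Proof.
move=> eO yh zy s s01.
have [lh|hl] := ltP `|lin s c z - c| h; first exact: SO.
apply: eO.
have e1 : `|lin s c z - c| <= s * `|z - c|.
  rewrite linB; apply: le_trans (norm_lin_le s01 (lexx _) (lexx _)) _.
  by rewrite subrr normr0 mulr0 add0r.
have e2 : `|lin s c z - z| <= (1 - s) * `|z - c|.
  rewrite linB; apply: le_trans (norm_lin_le s01 (lexx _) (lexx _)) _.
  by rewrite subrr normr0 mulr0 addr0 distrC.
have := ler_distD y z c; have := ler_distD z (lin s c z) y; lra.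
Qed.

(** Consider the property of being joined to [B] outside the closed square: true at [B], false at
    [c]. Without a suitable [v] it would be locally constant on [Omega]: near a point of the closed
    square every point is visible from [c], so none has the property. [connected_shrink] then adds
    the margin [e]. *)
Lemma access : exists v A (e : R), [/\ segment_in Omega c v, connected A /\ 0 < e,
  A `<=` Omega, forall p, A p -> h + e < `|p - c| & A v /\ A B].
Proof.
suff [v [A [sv cA AO Ah [Av AB]]]] : exists v A, [/\ segment_in Omega c v, connected A,
    A `<=` Omega, forall p, A p -> h < `|p - c| & A v /\ A B].
  have [A' [e [? ? ? ? ?]]] := connected_shrink oO cA AO Ah Av AB.
  by exists v, A', e.
pose f y := exists A, [/\ connected A, A `<=` Omega, 
  forall p, A p -> h < `|p - c| & A y /\ A B].
have fB : f B by exists [set B]; split => //; [exact: connected1|move=> p ->|move=> p ->].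
have fc : ~ f c.
  by move=> [A [_ _ /(_ c) H [/H]]]; rewrite subrr normr0 => /lt_trans /(_ h0); rewrite ltxx.
apply: contrapT => nv; apply: fc.
suff -> : f c = f B by [].
apply: (connected_locally_constant cO) => [y Oy||]; last 2 first.
- exact: center_in.
- exact: OB.
have [yh|hy] := leP `|y - c| h.
  have : nbhs y Omega by exact: open_nbhs_nbhs.
  move=> /nbhs_normP[e /= e0 eO].
  have e20 : 0 < e / 2 by rewrite divr_gt0.
  apply: filterS (near_dist y e20) => z zy Oz; apply/propext; split.
  - move=> [A [cA AO Ah [Az AB]]]; case: nv; exists z, A; split => //.
    apply: (@segment_from_center y z e) => // x xy.
    by apply: eO; rewrite /= distrC.
  - by move=> [A [_ _ Ah [/Ah]]]; rewrite ltNge yh.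
have glue (a b : R * R) : segment_in Omega a b ->
    (forall s, 0 <= s <= 1 -> h < `|lin s a b - c|) -> f a -> f b.
  move=> ab Hab [A [cA AO Ah [Aa AB]]].
  exists (A `|` [set x | exists2 s, 0 <= s <= 1 & x = lin s a b]).
  have a0 : [set x | exists2 s, 0 <= s <= 1 & x = lin s a b] a.
    by exists 0; rewrite ?lin0 // lexx ler01.
  split.
  - by apply: connectedU => //; [exists a|exact: connected_segment].
  - by move=> p [/AO //|[s s01 ->]]; exact: ab.
  - by move=> p [/Ah //|[s s01 ->]]; exact: Hab.
  - by split; [right; exists 1; rewrite ?lin1 // lexx ler01|left].
have e0 : 0 < `|y - c| - h by rewrite subr_gt0.
apply: filterS2 (near_segment_in oO Oy) (near_dist y e0) => z yz zy Oz.
have H s : 0 <= s <= 1 -> h < `|lin s y z - c|.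
  move=> s01; have : `|lin s y z - y| < `|y - c| - h.
    by apply: (@convex_ball _ y (`|y - c| - h)) => //=; rewrite subrr normr0.
  have := ler_distD (lin s y z) y c; rewrite (distrC y (lin s y z)); lra.
apply/propext; split; apply: glue => //; first exact: segment_inC.
move=> s /andP[s0 s1]; rewrite lin_rev; apply: H.
by apply/andP; split; lra.
Qed.

(** The outside point on the boundary of the square, with its direction shifted by full turns, gives
    outside directions within 2 pi on either side of [tv]. The nearest ones exist because the set of
    outside directions is closed. *)
Lemma arc_ends tv : (exists2 w, ~ Omega w & `|w - c| = h) -> Omega (q tv) ->
  exists ta tb, [/\ tv - pi *+ 2 < ta < tv, tv < tb < tv + pi *+ 2,
    ~ Omega (q ta), ~ Omega (q tb) & forall t, ta < t < tb -> Omega (q t)].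
Proof.
move=> [w Ow wh] Oq; have pi0 := @pi_gt0 R.
have wc : w != c by apply/eqP => e; apply: Ow; rewrite e; exact: center_in.
have [t0 wE] := ray_ex wc; rewrite wh in wE.
have qper s t : congr2pi s t -> q s = q t by move=> st; rewrite /ray (unit_dir_congr st).
have [d dE /andP[d1 d2]] := congr2pi_norm (t0 - tv).
have Od k : ~ Omega (q (tv + d + pi *+ 2 *~ k)).
  rewrite (_ : q _ = w) // wE; apply: qper; apply: congr2pi_sym.
  have [l dl] := dE; exists (l - k); rewrite mulrzBr; lra.
have dn0 : d != 0.
  by apply/eqP => dz; apply: (Od 0); rewrite dz mulr0z !addr0.
have [tl tlv Otl] : exists2 t, tv - pi *+ 2 < t < tv & ~ Omega (q t).
  have [d0|d0] := ltP d 0.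
    exists (tv + d); last by have := Od 0; rewrite mulr0z addr0.
    by apply/andP; split; lra.
  exists (tv + d - pi *+ 2); last by have := Od (-1); rewrite mulrNz mulr1z.
  have d0' : 0 < d by rewrite lt_neqAle eq_sym dn0.
  by apply/andP; split; lra.
have [tr trv Otr] : exists2 t, tv < t < tv + pi *+ 2 & ~ Omega (q t).
  have [d0|d0] := ltP d 0.
    exists (tv + d + pi *+ 2); last by have := Od 1; rewrite mulr1z.
    by apply/andP; split; lra.
  exists (tv + d); last by have := Od 0; rewrite mulr0z addr0.
  have d0' : 0 < d by rewrite lt_neqAle eq_sym dn0.
  by apply/andP; split; lra.
have clE : closed [set t | ~ Omega (q t)].
  rewrite (_ : [set t | _] = q @^-1` (~` Omega)) //.
  apply: preimage_closed; last exact: open_closedC.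
  by move=> t _; exact: continuous_ray_dir.
have [ta [tatl tatv Ota taO]] : exists ta, [/\ tl <= ta, ta < tv, ~ Omega (q ta) &
    forall t, ta < t <= tv -> Omega (q t)].
  have cK : compact (`[tl, tv] `&` [set t | ~ Omega (q t)]).
    by apply: compact_closedI => //; exact: segment_compact.
  have K0 : `[tl, tv] `&` [set t | ~ Omega (q t)] !=set0.
    by exists tl; split => //; rewrite /= in_itv /= lexx; lra.
  have [ta /set_mem[+ Ota] tamax] := compact_EVT_max K0 cK
    (continuous_subspaceT (fun x : R => @cvg_id _ (nbhs x))).
  rewrite /= in_itv /= => /andP[ta1 ta2]; exists ta; split => //.
    by rewrite lt_neqAle ta2 andbT; apply/eqP => e; apply: Ota; rewrite e.
  move=> t /andP[tat ttv]; apply: contrapT => Ot.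
  have := tamax t; rewrite leNgt tat => /(_ (mem_set _))/negP; apply => //.
  by split => //; rewrite /= in_itv /= ttv andbT (le_trans ta1) // ltW.
have [tb [tbtr tbtv Otb tbO]] : exists tb, [/\ tb <= tr, tv < tb, ~ Omega (q tb) &
    forall t, tv <= t < tb -> Omega (q t)].
  have cK : compact (`[tv, tr] `&` [set t | ~ Omega (q t)]).
    by apply: compact_closedI => //; exact: segment_compact.
  have K0 : `[tv, tr] `&` [set t | ~ Omega (q t)] !=set0.
    by exists tr; split => //; rewrite /= in_itv /= lexx; lra.
  have [tb /set_mem[+ Otb] tbmin] := compact_EVT_min K0 cK
    (continuous_subspaceT (fun x : R => @cvg_id _ (nbhs x))).
  rewrite /= in_itv /= => /andP[tb1 tb2]; exists tb; split => //.
    by rewrite lt_neqAle tb1 andbT; apply/eqP => e; apply: Otb; rewrite -e.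
  move=> t /andP[tvt ttb]; apply: contrapT => Ot.
  have := tbmin t; rewrite leNgt ttb => /(_ (mem_set _))/negP; apply => //.
  by split => //; rewrite /= in_itv /= tvt /= (le_trans _ tb2) // ltW.
exists ta, tb; split => //.
- by apply/andP; split; lra.
- by apply/andP; split; lra.
- move=> t /andP[t1 t2]; have [ttv|tvt] := leP t tv.
    by apply: taO; rewrite t1.
  by apply: tbO; rewrite t2 ltW.
Qed.

Variables (nr : R * R -> R * R) (th : R * R -> R * R -> R).
Hypotheses (nrO : forall z, ~ Omega (nr z))
  (nrP : forall z x, ~ Omega x -> `|z - nr z| <= `|z - x|)
  (thP : forall w, ~ Omega w -> angle_fun Omega w (th w)).

Definition dist_out z := `|z - nr z|.
Local Notation d := dist_out.

Lemma dist_lip z z' : d z <= d z' + `|z - z'|.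
Proof.
rewrite /dist_out; apply: le_trans (nrP z (@nrO z')) _; rewrite [X in _ <= X]addrC.
exact: ler_distD.
Qed.

Lemma dist_cvg : continuous d.
Proof.
move=> z; apply/cvgrPdist_lt => e e0.
apply: filterS (near_dist z e0) => y yz.
apply: le_lt_trans yz; rewrite ler_norml; have := dist_lip z y; have := dist_lip y z.
by rewrite (distrC z y) => ? ?; apply/andP; split; lra.
Qed.

Definition angle_change w := th w B - th w c.
Local Notation Theta := angle_change.

(** The ball of radius [rho - h] about [ray c rho t] is the largest one in [Omega] with that centre,
    and its boundary meets that of the given square at [q t]. *)
Definition touching t rho := h < rho /\ d (ray c rho t) = rho - h.

                                                                                
                                                                                
                                                                         
(** The first three terms are the turning from [c] to [B] seen from the centre [z] itself,
    transported from the outside point [nr z]. Under [nosep], for [q t] in [Omega] and touching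
    [rho], the whole is congruent modulo 2 pi to the direction of [c - B], so only its branch could
    vary. *)
Definition sweep t rho := let z := ray c rho t in
  Theta (nr z) + vang B (nr z) z - vang c (nr z) z - vang B c z + t.

(** The turning transported to [z] does not depend on the outside point used, as long as all points
    involved lie in one closed ball avoided by a connected set joining [c] to [B]. *)
Lemma Theta_change C y r z w w' : connected C -> C `<=` Omega ->
  (forall p, C p -> r < `|p - y|) -> C c -> C B -> ~ Omega w -> ~ Omega w' ->
  `|w - y| <= r -> `|w' - y| <= r -> `|z - y| <= r ->
  Theta w + vang B w z - vang c w z = Theta w' + vang B w' z - vang c w' z.
Proof.
move=> cC CO Cr Cc CB Ow Ow' wr w'r zr.
have cK := @convex_closed_ball R y r.
have CK p : C p -> ~ [set x | `|x - y| <= r] p by move=> /Cr; rewrite /= leNgt => ->.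
have := angle_fun_diff oO (thP Ow) (thP Ow') Ow Ow' cK wr w'r cC CO CK Cc CB.
rewrite -/(Theta w) -/(Theta w').
have := vang_add cK (CK _ CB) wr w'r zr; have := vang_add cK (CK _ Cc) wr w'r zr.
lra.
Qed.

                                                                             
(** The negation of the conclusion for the candidate squares: [B] is outside the closed square, and
    [c] and [B] are not separated by it. *)
Hypothesis nosep : forall t rho, Omega (q t) -> touching t rho ->
  rho - h < `|B - ray c rho t| /\
  exists C, [/\ connected C, C `<=` Omega,
    forall p, C p -> rho - h < `|p - ray c rho t| & C c /\ C B].

(** By [connected_shrink], the joining set avoids a slightly larger closed ball, which contains the
    centres and nearest outside points of all nearby touching squares. Transport and additivity of
    angles take place inside that ball. *)
Lemma sweep_locally_constant t0 rho0 : Omega (q t0) -> touching t0 rho0 ->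
  \forall p \near (t0, rho0), touching p.1 p.2 -> sweep p.1 p.2 = sweep t0 rho0.
Proof.
move=> Oq0 M0; have [rho0h dz0] := M0.
have [Bz0 [C' [cC' C'O C'r [C'c C'B]]]] := nosep Oq0 M0.
have [C [e [cC e0 CO Cr [Cc CB]]]] := connected_shrink oO cC' C'O C'r C'c C'B.
set z0 := ray c rho0 t0 in dz0 Bz0 C'r Cr *.
have e4 : 0 < e / 4 by rewrite divr_gt0.
have cz : \forall p \near (t0, rho0), `|ray c p.2 p.1 - z0| < e / 4.
  have /cvgr_distC_lt := @continuous_ray R c (t0, rho0).
  exact.
have cp : \forall p \near (t0, rho0), `|p - (t0, rho0)| < Num.min (e / 4) pi.
  by apply: near_dist; rewrite lt_min e4 pi_gt0.
apply: filterS2 cz cp => -[t rho] /=; set z := ray c rho t.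
move=> zz0; rewrite lt_min !pair_norm_lt => /andP[/andP[/= t1 rho1] /andP[/= t2 _]] [rhoh dz].
have pt : `|t - t0| < pi by [].
have cK := @convex_closed_ball R z0 (rho0 - h + e).
have CK p : C p -> ~ [set x | `|x - z0| <= rho0 - h + e] p by move=> /Cr; rewrite /= leNgt => ->.
have rho_abs := ler_norm (rho - rho0).
have z0K : `|z0 - z0| <= rho0 - h + e by rewrite subrr normr0; lra.
have zK : `|z - z0| <= rho0 - h + e by lra.
have w0K : `|nr z0 - z0| <= rho0 - h + e by rewrite distrC; move: dz0; rewrite /dist_out; lra.
have wK : `|nr z - z0| <= rho0 - h + e.
  have := ler_distD z (nr z) z0; rewrite (distrC (nr z) z).
  move: dz; rewrite /dist_out -/z; lra.
rewrite /sweep /= -/z -/z0.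
have := Theta_change cC CO Cr Cc CB (@nrO z) (@nrO z0) wK w0K zK.
have EB := vang_add cK (CK _ CB) w0K z0K zK.
have Ec := vang_add cK (CK _ Cc) w0K z0K zK.
(* The thin triangle from [c] to the nearby centres is covered by the given square and the enlarged
   ball, and [B] lies outside both. *)
have EBc : vang B c z0 + vang B z0 z = vang B c z.
  apply: vang_triangle => s u s01 u01.
  have mz0 : `|lin u z0 z - z0| < e / 4.
    by apply: (@convex_ball _ z0 (e / 4)) => //=; rewrite subrr normr0.
  apply: (@lin_two_balls _ _ _ z0 _ h (rho0 - h + e)) => //; first exact: ltW.
    have := ler_distD z0 (lin u z0 z) c; rewrite /z0 norm_rayB -/z0.
    rewrite gtr0_norm ?(lt_trans h0) //; lra.
  exact: Cr.
have Et : vang c z0 z = t - t0 by apply: vang_ray => //; exact: (lt_trans h0).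
lra.
Qed.

Lemma near_scale_le (r s0 : R) : h < r -> s0 <= 1 ->
  \forall s \near s0, s <= 1 -> r * s - h * s0 <= r - h.
Proof.
move=> hr; rewrite le_eqVlt => /orP[/eqP s0E|s01].
  apply: filterS (near_dist s0 (@ltr01 R)) => s _ s1.
  by rewrite s0E mulr1 lerD2r ler_piMr // (le_trans (ltW h0)) // ltW.
have cl : r * s - h * s0 @[s --> s0] --> r * s0 - h * s0.
  by apply: cvgB; [apply: cvgM; [exact: cvg_cst|exact: cvg_id]|exact: cvg_cst].
have lt : r * s0 - h * s0 < r - h by nra.
have N : \forall s \near s0, r * s - h * s0 < r - h by exact: (cvgr_lt _ cl _ lt).
by apply: filterS N => s /ltW.
Qed.

Lemma near_scale_norm_le (r s0 : R) : h < r -> `|s0| <= 1 ->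
  \forall s \near s0, `|s| <= 1 -> `|r * s - h * s0| <= r - h.
Proof.
move=> hr; rewrite ler_norml => /andP[s0l s0r].
have s0l' : - s0 <= 1 by lra.
have H := near_scale_le hr s0r.
have H' : \forall s \near s0, - s <= 1 -> r * - s - h * - s0 <= r - h.
  have co : - s @[s --> s0] --> - s0 by apply: cvgN; exact: cvg_id.
  exact: (co _ (near_scale_le hr s0l')).
apply: filterS2 H H' => s Hs Hs'; rewrite !ler_norml => /andP[? ?].
by apply/andP; split; [have := Hs'; lra|exact: Hs].
Qed.

                                                                         
                                                                                 
                                            
(** This uses the flat sides of squares: a coordinate of [unit_dir a] equal to 1 or -1 cannot be
    exceeded by [unit_dir t], and in the remaining bounds there is room for continuity. It fails for
    round discs. Larger [r] follow since the balls increase with [r]. *)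
Lemma near_touching_ball (a r1 : R) : h < r1 ->
  \forall t \near a, forall r, r1 <= r -> `|ray c r t - q a| <= r - h.
Proof.
move=> hr1.
have nu t : `|(unit_dir t).1 : R| <= 1 /\ `|(unit_dir t).2 : R| <= 1.
  have : `|unit_dir t : R * R| <= 1 by rewrite norm_unit_dir.
  by rewrite pair_norm_le => /andP[].
have H1 : \forall t \near a, `|r1 * (unit_dir t).1 - h * (unit_dir a).1| <= r1 - h.
  have c1 := cvg_fst1 (@continuous_unit_dir R a).
  have N : \forall t \near a, `|(unit_dir t).1| <= 1 ->
      `|r1 * (unit_dir t).1 - h * (unit_dir a).1| <= r1 - h.
    exact: (c1 _ (near_scale_norm_le hr1 (nu a).1)).
  by apply: filterS N => t /(_ (nu t).1).
have H2 : \forall t \near a, `|r1 * (unit_dir t).2 - h * (unit_dir a).2| <= r1 - h.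
  have c1 := cvg_snd1 (@continuous_unit_dir R a).
  have N : \forall t \near a, `|(unit_dir t).2| <= 1 ->
      `|r1 * (unit_dir t).2 - h * (unit_dir a).2| <= r1 - h.
    exact: (c1 _ (near_scale_norm_le hr1 (nu a).2)).
  by apply: filterS N => t /(_ (nu t).2).
apply: filterS2 H1 H2 => t H1 H2 r r1r.
have : `|ray c r1 t - q a| <= r1 - h.
  have -> : ray c r1 t - q a = r1 *: unit_dir t - h *: unit_dir a.
    by rewrite /ray opprD addrACA subrr add0r.
  by rewrite pair_norm_le /=; apply/andP.
have := ler_distD (ray c r1 t) (ray c r t) (q a); rewrite norm_ray_ray.
rewrite ger0_norm ?subr_ge0 //; lra.
Qed.

(** Close to a direction [a] whose boundary point is outside [Omega], [q a] can replace [nr z]. A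
    small touching square lies near [q a], away from the segment to [v] and from [A]; a large one
    contains [q a] in its closure, so the set from [nosep] serves. *)
Lemma sweep_end a v A (e : R) : ~ Omega (q a) -> segment_in Omega c v ->
  connected A -> 0 < e -> A `<=` Omega -> (forall p, A p -> h + e < `|p - c|) ->
  A v -> A B ->
  \forall t \near a, Omega (q t) -> forall rho, touching t rho ->
    sweep t rho = Theta (q a) - vang B c (q a) + a.
Proof.
move=> Oa cv cA e0 AO Ae Av AB.
pose C1 := A `|` [set x | exists2 s, 0 <= s <= 1 & x = lin s c v].
have cC1 : connected C1.
  apply: connectedU => //; last exact: connected_segment.
  by exists v; split => //; exists 1; rewrite ?lin1 // lexx ler01.
have C1O : C1 `<=` Omega by move=> p [/AO //|[s s01 ->]]; exact: cv.
have C1c : C1 c by right; exists 0; rewrite ?lin0 // lexx ler01.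
have C1B : C1 B by left.
have [dl dl0 C1dl] : exists2 dl, 0 < dl & forall p, C1 p -> dl < `|p - q a|.
  have cf : {within `[0, 1], continuous (fun s => `|lin s c v - q a|)}.
    apply: continuous_subspaceT => s; apply: cvg_norm; apply: cvgB; last exact: cvg_cst.
    by apply: cvg_lin; [exact: cvg_id|exact: cvg_cst|exact: cvg_cst].
  have [s1 s1I s1min] := EVT_min ler01 cf.
  have m0 : 0 < `|lin s1 c v - q a|.
    rewrite normr_gt0 subr_eq0; apply/eqP => E; apply: Oa; rewrite -E.
    by apply: cv; move: s1I; rewrite in_itv.
  (* Points of [A] are more than [e] from [q a], which is at distance [h] from [c]; the compact
     segment from [c] to [v] stays away from [q a] by its minimum distance, halved to be strict. *)
  exists (Num.min e (`|lin s1 c v - q a| / 2)).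
    by rewrite lt_min e0 divr_gt0.
  move=> p [/Ae pe|[s s01 ->]]; rewrite gt_min; apply/orP; [left|right].
    have := ler_distD (q a) p c; rewrite norm_rayB gtr0_norm //; lra.
  have := s1min s; rewrite in_itv /= => /(_ s01); lra.
have dl2 : 0 < dl / 2 by rewrite divr_gt0.
have n1 : \forall t \near a, `|q t - q a| < dl / 2.
  by have /cvgr_distC_lt := @continuous_ray_dir R c h a; exact.
have hr1 : h < h + dl / 4 by rewrite ltrDl divr_gt0.
apply: filterS3 n1 (near_dist a (@pi_gt0 R)) (near_touching_ball a hr1).
move=> t qt ta near_ball Oqt rho M.
have [rhoh dz] := M.
have [Bz [C [cC CO Cr [Cc CB]]]] := nosep Oqt M.
set z := ray c rho t in dz Bz Cr *.
have zqt : `|z - q t| = rho - h.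
  by rewrite norm_ray_ray gtr0_norm // subr_gt0.
have zc : `|z - c| = rho by rewrite norm_rayB gtr0_norm // (lt_trans h0).
have qac : `|q a - c| = h by rewrite norm_rayB gtr0_norm.
have zqa := ler_distD (q t) z (q a).
have mc u : 0 <= u <= 1 -> `|lin u (q a) z - c| <= (1 - u) * h + u * rho.
  by move=> u01; rewrite linB; apply: norm_lin_le => //; [rewrite qac|rewrite zc].
have ma u : 0 <= u <= 1 -> `|lin u (q a) z - q a| <= u * `|z - q a|.
  move=> u01; rewrite linB; apply: le_trans (norm_lin_le u01 (lexx _) (lexx _)) _.
  by rewrite subrr normr0 mulr0 add0r.
have mz u : 0 <= u <= 1 -> `|lin u (q a) z - z| <= (1 - u) * `|z - q a|.
  move=> u01; rewrite linB; apply: le_trans (norm_lin_le u01 (lexx _) (lexx _)) _.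
  by rewrite subrr normr0 mulr0 addr0 distrC.
have nz : `|nr z - z| = rho - h by rewrite distrC -dz.
suff [EC EB] : Theta (nr z) + vang B (nr z) z - vang c (nr z) z =
      Theta (q a) + vang B (q a) z - vang c (q a) z /\
    vang B c (q a) + vang B (q a) z = vang B c z.
  have Et : vang c (q a) z = t - a by apply: vang_ray => //; exact: lt_trans rhoh.
  rewrite /sweep -/z; lra.
have [rsmall|rbig] := ltP (rho - h) (dl / 4).
  split.
    have nzq : `|nr z - q a| <= dl by have := ler_distD z (nr z) (q a); lra.
    have qq : `|q a - q a| <= dl by rewrite subrr normr0 ltW.
    have zq : `|z - q a| <= dl by lra.
    exact: (Theta_change cC1 C1O C1dl C1c C1B (@nrO z) Oa nzq qq zq).
  apply: vang_triangle => s u s01 u01.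
  apply: (@lin_two_balls _ _ _ (q a) _ h dl) => //; [exact: ltW| |exact: C1dl].
  have := mc u u01; have := ma u u01; move: u01 => /andP[? ?]; nra.
have zqa' : `|z - q a| <= rho - h by apply: near_ball; lra.
split.
  have nz' : `|nr z - z| <= rho - h by rewrite nz.
  have qz : `|q a - z| <= rho - h by rewrite distrC.
  have zz : `|z - z| <= rho - h by rewrite subrr normr0 subr_ge0 ltW.
  exact: (Theta_change cC CO Cr Cc CB (@nrO z) Oa nz' qz zz).
apply: vang_triangle => s u s01 u01.
apply: (@lin_two_balls _ _ _ z _ h (rho - h)) => //; first exact: ltW.
have := mc u u01; have := mz u u01; move: u01 => /andP[? ?]; nra.
Qed.

Lemma dist_out_gt0 z : Omega z -> 0 < d z.
Proof.
move=> Oz; rewrite /dist_out normr_gt0 subr_eq0; apply/eqP => E.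
by apply: (@nrO z); rewrite -E.
Qed.

Lemma dist_out_eq0 z : ~ Omega z -> d z = 0.
Proof.
move=> Oz; apply/eqP; rewrite -normr_le0 /dist_out normr_id.
by have := nrP z Oz; rewrite subrr normr0.
Qed.

(** The distance to the complement is 1-Lipschitz while the touching equation has slope 1, so
    equality at two radii forces it between them. Touching radii need not be unique, but they form
    an interval. *)
Lemma touching_between t r1 r2 r : touching t r1 -> touching t r2 -> r1 <= r <= r2 ->
  touching t r.
Proof.
move=> [r1h d1] [r2h d2] /andP[r1r rr2]; split; first exact: lt_le_trans r1r.
have := dist_lip (ray c r t) (ray c r1 t); have := dist_lip (ray c r2 t) (ray c r t).
rewrite !norm_ray_ray !ger0_norm ?subr_ge0 // d1 d2 => ? ?.
by apply/eqP; rewrite eq_le; apply/andP; split; lra.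
Qed.

Lemma sweep_fiber t r1 r2 : Omega (q t) -> touching t r1 -> touching t r2 ->
  sweep t r1 = sweep t r2.
Proof.
move=> Oqt M1 M2.
have cI : connected [set r | touching t r].
  apply/connected_intervalP => x y /= Mx My z; exact: touching_between.
apply: (connected_locally_constant cI) => // r Mr.
have cr : (t, s) @[s --> r] --> ((t, r) : R * R).
  by apply: cvg_mkpair; [exact: cvg_cst|exact: cvg_id].
by have := cr _ (sweep_locally_constant Oqt Mr).
Qed.

Variable D : R.
Hypothesis bddO : forall x, Omega x -> `|x| <= D.

Lemma touching_bound t rho : touching t rho -> rho <= D + `|c|.
Proof.
move=> [rhoh dz]; have : Omega (ray c rho t).
  by apply: contrapT => /dist_out_eq0 d0; move: dz rhoh; rewrite d0; lra.
move=> /bddO; have := norm_rayB c rho t; rewrite gtr0_norm ?(lt_trans h0) // => E.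
have := ler_normB (ray c rho t) c; rewrite E; lra.
Qed.

Lemma touching_ex t : Omega (q t) -> exists rho, touching t rho.
Proof.
move=> Oqt; pose f rho := rho - h - d (ray c rho t).
(* Large enough for the point of the ray at radius [b] to be outside the bounded set [Omega], where
   the distance is 0. *)
pose b := Num.max h (D + `|c| + 1).
have hb : h <= b by rewrite le_max lexx.
have cf : {within `[h, b], continuous f}.
  apply: continuous_subspaceT => rho; apply: cvgB.
    by apply: cvgB; [exact: cvg_id|exact: cvg_cst].
  apply: (@cvg_comp _ _ _ (fun r => ray c r t) d); last exact: dist_cvg.
  apply: cvgD; first exact: cvg_cst.
  by apply: cvgZ; [exact: cvg_id|exact: cvg_cst].
have fh : f h < 0 by rewrite /f subrr sub0r oppr_lt0; exact: dist_out_gt0.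
have fb : 0 <= f b.
  rewrite /f dist_out_eq0 ?subr0 ?subr_ge0 //.
  move=> /bddO H; have := norm_rayB c b t.
  rewrite gtr0_norm ?(lt_le_trans h0) // => E.
  have := ler_normB (ray c b t) c; rewrite E.
  have : D + `|c| + 1 <= b by rewrite le_max lexx orbT.
  lra.
have [|rho] := @IVT _ f h b 0 hb cf.
  by rewrite ge_min le_max fb (ltW fh) orbT.
rewrite in_itv /= => /andP[rho1 _] frho; exists rho; split.
  rewrite lt_neqAle rho1 andbT; apply/eqP => E; move: fh; rewrite E frho; lra.
by move: frho; rewrite /f; lra.
Qed.

(** The choice [g] of a touching radius need not be continuous. All touching radii lie in one
    compact interval and [sweep] is constant on each fibre, so local constancy holds uniformly over
    all radii touching near [t0]. *)
Lemma sweep_const ta tb t1 t2 r1 r2 : (forall t, ta < t < tb -> Omega (q t)) ->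
  ta < t1 < tb -> ta < t2 < tb -> touching t1 r1 -> touching t2 r2 ->
  sweep t1 r1 = sweep t2 r2.
Proof.
move=> tO t1I t2I M1 M2.
have /choice[g gP] : forall t, exists rho, Omega (q t) -> touching t rho.
  move=> t; have [/touching_ex[rho ?]|?] := pselect (Omega (q t)); first by exists rho.
  by exists 0.
rewrite (sweep_fiber (tO _ t1I) M1 (gP _ (tO _ t1I))).
rewrite (sweep_fiber (tO _ t2I) M2 (gP _ (tO _ t2I))).
have cI : connected [set` `]ta, tb[].
  by apply/connected_intervalP; exact: interval_is_interval.
apply: (@connected_locally_constant _ _ _ (fun t => sweep t (g t)) cI);
  rewrite /= ?in_itv // => t0 t0I {t1 t2 r1 r2 t1I t2I M1 M2}.
have Ot0 := tO _ t0I.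
have /compact_near_coveringP := @segment_compact R h (D + `|c|).
move=> /(_ R (nbhs t0) (fun t r => touching t r -> sweep t r = sweep t0 (g t0)) _) H.
have {}H : \forall t \near t0, `[h, D + `|c|] `<=`
    (fun r => touching t r -> sweep t r = sweep t0 (g t0)).
  apply: H => r; rewrite /= in_itv /= => /andP[hr _].
  have : \forall p \near (t0, r), touching p.1 p.2 -> sweep p.1 p.2 = sweep t0 (g t0).
    have [M|M] := pselect (touching t0 r).
      by rewrite (sweep_fiber Ot0 (gP _ Ot0) M); exact: sweep_locally_constant.
    have cl : p.2 - h - d (ray c p.2 p.1) @[p --> (t0, r)] --> r - h - d (ray c r t0).
      apply: cvgB; first by apply: cvgB; [exact: cvg_snd|exact: cvg_cst].
      apply: (@cvg_comp _ _ _ (fun p : R * R => ray c p.2 p.1) d); last exact: dist_cvg.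
      exact: (@continuous_ray R c (t0, r)).
    have n0 : r - h - d (ray c r t0) != 0.
      apply/eqP => E; apply: M; split; last by lra.
      rewrite lt_neqAle hr andbT; apply/eqP => rh; move: E (dist_out_gt0 Ot0).
      by rewrite -rh; lra.
    have N : \forall p \near (t0, r), p.2 - h - d (ray c p.2 p.1) != 0.
      exact: (cvgr_neq0 _ cl n0).
    by apply: filterS N => p np [_ E]; move: np; rewrite E subrr eqxx.
  move=> [[U V] /= [nU nV] UV]; exists (V, U) => //= -[r' t] /= [Vr Ut].
  exact: (UV (t, r')).
apply: filterS H => t Ht tI; rewrite /= in_itv /= in tI.
apply: Ht; last exact: gP (tO _ tI).
have M := gP _ (tO _ tI).
by rewrite /= in_itv /= (touching_bound M) andbT ltW //; case: M.
Qed.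

Lemma separation_absurd : (exists2 w, ~ Omega w & `|w - c| = h) -> False.
Proof.
move=> wex.
have [v [A [e [cv [cA e0] AO Ae [Av AB]]]]] := access.
have vh : h < `|v - c| by have := Ae _ Av; lra.
have vc : v != c by rewrite -subr_eq0 -normr_gt0 (lt_trans h0).
have [tv vE] := ray_ex vc.
set rv := `|v - c| in vh vE.
have rv0 : 0 < rv by exact: lt_trans vh.
have Oqv : Omega (q tv).
  have -> : q tv = lin (h / rv) c v.
    by rewrite vE lin_ray divfK // gt_eqF.
  apply: cv; rewrite divr_ge0 ?(ltW h0) ?(ltW rv0) //=.
  by rewrite ler_pdivrMr // mul1r ltW.
have [ta [tb [taI tbI Ota Otb tO]]] := arc_ends wex Oqv.
have tab : ta < tb by lra.
have [t1 [t1I [rho1 M1] E1]] : exists t, [/\ ta < t < tb, exists rho, touching t rho &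
   forall rho, touching t rho -> sweep t rho = Theta (q ta) - vang B c (q ta) + ta].
  have [t tI H'] := near_right_witness tab (sweep_end Ota cv cA e0 AO Ae Av AB).
  exists t; split => //; first exact: touching_ex (tO _ tI).
  exact: H' (tO _ tI).
have [t2 [t2I [rho2 M2] E2]] : exists t, [/\ ta < t < tb, exists rho, touching t rho &
   forall rho, touching t rho -> sweep t rho = Theta (q tb) - vang B c (q tb) + tb].
  have [t tI H'] := near_left_witness tab (sweep_end Otb cv cA e0 AO Ae Av AB).
  exists t; split => //; first exact: touching_ex (tO _ tI).
  exact: H' (tO _ tI).
have := sweep_const tO t1I t2I M1 M2; rewrite (E1 _ M1) (E2 _ M2) => Eab.
have cK := @convex_closed_ball R c h.
have CK p : A p -> ~ [set x | `|x - c| <= h] p.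
  by move=> /Ae pe /=; apply/negP; rewrite -ltNge; lra.
have qK t : `|q t - c| <= h by rewrite norm_rayB gtr0_norm.
have cc : `|c - c| <= h by rewrite subrr normr0 ltW.
(* From [v] to [B] the set [A] avoids the closed square, so both ends can be compared there; from
   [c] to [v] the turning is a single angle ([Ea], [Eb]). What remains is the equality of
   [base_angles] at [ta] and [tb], whereas [Tb] and [Ta] differ by 2 pi. *)
have ED := angle_fun_diff oO (thP Ota) (thP Otb) Ota Otb cK (qK ta) (qK tb) cA AO CK Av AB.
have EB := vang_add cK (CK _ AB) cc (qK ta) (qK tb).
have Ev := vang_add cK (CK _ Av) cc (qK ta) (qK tb).
have Ea := thP Ota cv; have Eb := thP Otb cv.
have Tb := triangle_right c h0 vh tbI; have Ta := triangle_left c h0 vh taI.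
have pi0 := @pi_gt0 R.
move: Tb Ta Eab ED Ea Eb; rewrite /base_angles -vE /angle_change; lra.
Qed.

End Separation.

(** * Squares as sup-norm balls, and the theorem *)

Lemma norm_ball_prod (R : realType) (z : R * R) (r : R) :
  [set x : R * R | `|x - z| < r] = `]z.1 - r, z.1 + r[ `*` `]z.2 - r, z.2 + r[.
Proof.
apply/seteqP; split => x /=; rewrite !in_itv /= pair_norm_lt !ltr_norml /=.
  by move=> /andP[/andP[? ?] /andP[? ?]]; split; apply/andP; split; lra.
by move=> [/andP[? ?] /andP[? ?]]; apply/andP; split; apply/andP; split; lra.
Qed.

Lemma is_square_norm_ball (R : realType) (z : R * R) (r : R) : 0 < r ->
  is_square [set x : R * R | `|x - z| < r].
Proof.
move=> r0; exists (z.1 - r), (z.2 - r), (r *+ 2); split; first by rewrite pmulrn_lgt0.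
rewrite norm_ball_prod mulr2n.
by rewrite !addrA !subrK.
Qed.

Lemma is_square_ex (R : realType) (S : set (R * R)) : is_square S ->
  exists z (r : R), 0 < r /\ S = [set x : R * R | `|x - z| < r].
Proof.
move=> [a [b [l [l0 ->]]]]; exists (a + l / 2, b + l / 2), (l / 2).
split; first by rewrite divr_gt0.
rewrite norm_ball_prod /=.
by rewrite !addrK -!addrA -splitr.
Qed.

Lemma closure_norm_ball (R : realType) (z : R * R) (r : R) : 0 < r ->
  closure [set x : R * R | `|x - z| < r] = [set x : R * R | `|x - z| <= r].
Proof.
move=> r0; have := closed_ballE z r0; rewrite /closed_ball /closed_ball_ -ball_normE /=.
have -> : ball_ (fun x : R * R => `|x|) z r = [set x : R * R | `|x - z| < r].
  by apply/seteqP; split => x /=; rewrite distrC.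
by move=> ->; apply/seteqP; split => x /=; rewrite distrC.
Qed.

Theorem theorem2p6 (R : realType) (Omega S : set (R * R)) (B : R * R)
    (domain_Omega : domain Omega)
    (bounded_Omega : bounded_set Omega)
    (sc_Omega : simply_connected R Omega)
    (square_S : is_square S)
    (sub_S : S `<=` Omega)
    (touch_S : boundary S `&` boundary Omega !=set0)
    (HB : (Omega `\` closure S) B) :
  exists Q : set (R * R),
    [/\ is_square Q,
        Q `<=` Omega `\` closure S,
        closure Q `&` closure S `&` Omega !=set0
      & closure Q B \/
        exists C1 C2 : set (R * R),
          [/\ is_component (Omega `\` closure Q) C1,
              is_component (Omega `\` closure Q) C2,
              C1 <> C2, S `<=` C1 & C2 B]].
Proof.
have [oO cO] := domain_Omega.
have [c [h [h0 SE]]] := is_square_ex square_S.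
have clS : closure S = [set x : R * R | `|x - c| <= h] by rewrite SE closure_norm_ball.
have SO x : `|x - c| < h -> Omega x by move=> xc; apply: sub_S; rewrite SE.
have [OB nSB] := HB.
have Bh : h < `|B - c| by move: nSB; rewrite clS /= => /negP; rewrite -ltNge.
have [w [[clw _] [_ niw]]] := touch_S.
have Ow : ~ Omega w by move: niw; rewrite (interior_id _).1.
have wh : `|w - c| = h.
  move: clw; rewrite clS /= => clw; apply/eqP; rewrite eq_le clw /= leNgt.
  by apply/negP => /SO.
have [D bddO] : exists D : R, forall x : R * R, Omega x -> `|x| <= D.
  have [M [_ HM]] := bounded_Omega.
  by exists (M + 1) => x Ox; apply: HM => //; rewrite ltrDl.
have /choice[nr nrP] : forall z : R * R, exists w, ~ Omega w /\
    forall x, ~ Omega x -> `|z - w| <= `|z - x|.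
  move=> z; have [|u Ou umin] := nearest_point z (open_closedC oO).
    by exists w.
  by exists u.
have /choice[th thP] : forall w : R * R, exists t, ~ Omega w -> angle_fun Omega w t.
  move=> u; have [Ou|Ou] := pselect (Omega u); first by exists (fun=> 0).
  by have [t ?] := angle_function sc_Omega Ou oO cO; exists t.
(* If no square works, every touching square fails; this supplies [nosep]. *)
apply: contrapT => nQ.
apply: (@separation_absurd R Omega c B h oO cO h0 SO OB Bh nr th (fun z => (nrP z).1)
  (fun z => (nrP z).2) thP _ D bddO); last by exists w.
move=> t rho Oq [rhoh dz].
set z := ray c rho t in dz *; pose r := rho - h.
have r0 : 0 < r by rewrite subr_gt0.
pose Q := [set x : R * R | `|x - z| < r].
have clQ : closure Q = [set x : R * R | `|x - z| <= r] by rewrite closure_norm_ball.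
have zc : `|z - c| = rho by rewrite norm_rayB gtr0_norm // (lt_trans h0).
have QO : Q `<=` Omega `\` closure S.
  move=> x; rewrite /Q /r /= => xz; split.
    apply: contrapT => Ox; have := (nrP z).2 x Ox.
    by move: dz xz; rewrite /dist_out (distrC x z) => -> /lt_le_trans H /H; rewrite ltxx.
  rewrite clS /= => xc; have := ler_distD x z c; rewrite zc (distrC z x).
  by move: xz; lra.
have Qtouch : closure Q `&` closure S `&` Omega !=set0.
  exists (ray c h t); split => //; split; rewrite ?clQ ?clS /=.
    by rewrite distrC norm_ray_ray gtr0_norm.
  by rewrite norm_rayB gtr0_norm.
have SQ x : S x -> ~ closure Q x.
  rewrite SE clQ /= => xc xz; have := ler_distD x z c.
  by rewrite zc (distrC z x); move: xz; rewrite /r; lra.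
have cS : S c by rewrite SE /= subrr normr0.
have BQ : ~ closure Q B.
  by move=> QB; apply: nQ; exists Q; split => //; [exact: is_square_norm_ball|left].
split; first by move: BQ; rewrite clQ /= => /negP; rewrite -ltNge.
pose E := Omega `\` closure Q.
have Ec : E c by split; [exact: sub_S|exact: SQ].
have EB : E B by [].
have SC : S `<=` connected_component E c.
  move=> x Sx; apply: (@connected_component_max _ E _ c _ _ (@connected_segment R c x)).
  - by exists 0; rewrite ?lin0 // lexx ler01.
  - move=> y [s s01 ->]; have Sy : S (lin s c x).
      rewrite SE; apply: (@convex_ball R c h) => //=; first by rewrite subrr normr0.
      by move: Sx; rewrite SE.
    by split; [exact: sub_S|exact: SQ].
  - by exists 1; rewrite ?lin1 // lexx ler01.
(* Otherwise [Q] would separate the given square from [B]. The common component is then the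
   connected set required by [nosep]. *)
have CE : connected_component E c = connected_component E B.
  apply: contrapT => CE; apply: nQ; exists Q; split => //.
    exact: is_square_norm_ball.
  right; exists (connected_component E c), (connected_component E B); split => //.
  - by exists c.
  - by exists B.
  - exact: connected_component_refl.
exists (connected_component E c); split.
- exact: component_connected.
- by move=> x /connected_component_sub[].
- move=> p /connected_component_sub[_]; rewrite clQ /= => /negP.
  by rewrite -ltNge.
- split; first exact: connected_component_refl.
  by rewrite CE; exact: connected_component_refl.
Qed.
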